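(* Let $n\ge3$. (1) If $2\le k\le n$, then there is an $n$-polytope $C\subset\mathbb{R}^n$ having $n+k+2$ facets such that not every $C$-ball convex set is $k$-generated. (2) If $k\ge2$ and $C\subset\mathbb{R}^n$ is any $n$-polytope having at most $n+k+1$ facets, then every $C$-ball convex set is $k$-generated.
   Context: An $n$-polytope is an $n$-dimensional convex body (compact convex set with non-empty interior) that is the convex hull of finitely many points. A set $K\subset\mathbb{R}^n$ is $C$-ball convex if it is $\emptyset$, or $\mathbb{R}^n$, or the intersection of all translates of $C$ that contain $K$. The $C$-ball convex hull of a set $A$ is the intersection of all $C$-ball convex sets that contain $A$. For a fixed integer $k\ge2$, ''every $C$-ball convex set is $k$-generated'' means that every $C$-ball convex set is the $C$-ball convex hull of at most $k$ points. *)

(* Defs.v *)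
From HB Require Import structures.
From mathcomp Require Import all_boot all_order all_algebra.
From mathcomp Require Import all_classical all_reals all_analysis.

Set Implicit Arguments.
Unset Strict Implicit.
Unset Printing Implicit Defensive.

Import Order.TTheory GRing.Theory Num.Theory.
Import numFieldNormedType.Exports.

Local Open Scope classical_set_scope.
Local Open Scope card_scope.
Local Open Scope ring_scope.

(* R^n is represented by the row vectors ['rV[R]_n] over a [realType], with the
   product topology and the standard inner product. *)

Section Polytopes.
Variables (R : realType) (n : nat).
Implicit Types (A C F : set 'rV[R]_n).

Definition convex_hull A : set 'rV[R]_n :=
  smallest (fun B => convex_set (B : set (convex_lmodType 'rV[R]_n))) A.

Definition convex_body C : Prop :=
  [/\ compact C, convex_set (C : set (convex_lmodType 'rV[R]_n))
    & C° !=set0].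

Definition n_polytope C : Prop :=
  convex_body C /\ exists2 V : set 'rV[R]_n, finite_set V & C = convex_hull V.

Definition affine_set A : Prop :=
  forall (x y : 'rV[R]_n) (t : R), A x -> A y -> A ((1 - t) *: x + t *: y).

Definition affine_hull A : set 'rV[R]_n := smallest affine_set A.

(* The dimension of a nonempty set is that of the direction space of its affine
   hull; the empty set has no dimension in this sense. *)
Definition has_dim A (d : nat) : Prop :=
  exists x : 'rV[R]_n, exists2 U : {vspace 'rV[R]_n},
    affine_hull A = [set x + u | u in [set` U]] & \dim U = d.

Definition inner (u x : 'rV[R]_n) : R := \sum_(i < n) u 0 i * x 0 i.

(* [F] is cut out of [C] by a hyperplane having [C] on one of its sides. *)
Definition face C F : Prop :=
  exists (u : 'rV[R]_n) (c : R),
    [/\ u != 0, forall x, C x -> inner u x <= c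
      & F = C `&` [set x | inner u x = c]].

Definition facet C F : Prop := face C F /\ has_dim F n.-1.

Definition facets C : set (set 'rV[R]_n) := [set F | facet C F].

End Polytopes.

Section BallConvexity.
Variables (R : realType) (n : nat).
Implicit Types (A C K : set 'rV[R]_n).

Definition translate C (x : 'rV[R]_n) : set 'rV[R]_n := [set x + c | c in C].

Definition ball_convex C K : Prop :=
  [\/ K = set0, K = setT
    | K = \bigcap_(x in [set x | K `<=` translate C x]) translate C x].

Definition ball_convex_hull C A : set 'rV[R]_n := smallest (ball_convex C) A.

(* Generating sets with fewer than [k] points, including the empty one, are
   allowed. *)
Definition every_ball_convex_generated C (k : nat) : Prop :=
  forall K, ball_convex C K ->
    exists2 A : set 'rV[R]_n, A #<= `I_k & K = ball_convex_hull C A.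

End BallConvexity.

(* Main.v *)
(* A ball convex set other than the empty set and the whole space is a polytope
   [K = {x | <u_i, x> <= g_i}] with the facet normals [u_i] of [C], and it is the hull of any
   finite subset that meets all its faces [F_i = {x in K | <u_i, x> = g_i}].
   For (2), let [v] be a vertex of [K], let [T v] be the set of the [i] with [v] in [F_i], so
   that [#|T v| >= n], and let [S] be its complement. Seen from [v], the faces [F_i] with [i] in
   [S] cover a connected set, so the graph on [S] in which [i] and [j] are joined if [F_i] meets
   [F_j] is connected. If some [#|T v| > n], then [v], a point on one edge of this graph and one
   point for each remaining face are enough. Otherwise [K] is simple and each graph has at least
   three nodes; two disjoint edges, or three faces with a common point, save two points. If
   neither occurs for any vertex, then three pairwise meeting faces are excluded by an explicit
   point of their intersection, and a star with centre [c] and leaves [l], [l'] by counting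
   the constraints lost from [T v] at the vertices of [F_c] in [F_l] and in [F_l'] ([n >= 3]).
   For (1), cut off [k + 1] vertices of a simplex: the [k + 1] new facets are pairwise disjoint,
   so [k] points of [C / 2] miss one of its facets. *)
Require Import Defs.
From mathcomp Require Import all_boot all_order all_algebra finmap.
From mathcomp Require Import all_classical all_reals all_analysis.
From mathcomp Require Import ring lra zify.

Set Implicit Arguments.
Unset Strict Implicit.
Unset Printing Implicit Defensive.

Import Order.TTheory GRing.Theory Num.Theory.
Import numFieldNormedType.Exports.

Local Open Scope classical_set_scope.
Local Open Scope card_scope.
Local Open Scope ring_scope.

(** * Linear functionals and convex hulls *)

Lemma card_le_inj T U (f : T -> U) (A : set T) (B : set U) :
  {in A &, injective f} -> (forall x, A x -> B (f x)) -> A #<= B.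
Proof.
move=> fi fAB; apply: (@card_le_trans _ _ _ (f @` A)).
  by have /card_eqPle[] := inj_card_eq fi.
by apply: subset_card_le => _ [x Ax <-]; exact: fAB.
Qed.

Section Inner.
Variables (R : realType) (n : nat).
Implicit Types u v x y : 'rV[R]_n.

Lemma innerC u x : inner u x = inner x u.
Proof. by apply: eq_bigr => i _; rewrite mulrC. Qed.

Lemma innerDr u x y : inner u (x + y) = inner u x + inner u y.
Proof. by rewrite /inner -big_split; apply: eq_bigr => i _; rewrite mxE mulrDr. Qed.

Lemma innerZr u (a : R) x : inner u (a *: x) = a * inner u x.
Proof. by rewrite /inner mulr_sumr; apply: eq_bigr => i _; rewrite mxE mulrCA. Qed.

Lemma innerNr u x : inner u (- x) = - inner u x.
Proof. by rewrite -scaleN1r innerZr mulN1r. Qed.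

Lemma innerBr u x y : inner u (x - y) = inner u x - inner u y.
Proof. by rewrite innerDr innerNr. Qed.

Lemma inner0r u : inner u 0 = 0.
Proof. by rewrite -(scale0r 0) innerZr mul0r. Qed.

Lemma inner0l x : inner 0 x = 0.
Proof. by rewrite innerC inner0r. Qed.

Lemma innerDl u v x : inner (u + v) x = inner u x + inner v x.
Proof. by rewrite innerC innerDr !(innerC x). Qed.

Lemma innerZl (a : R) u x : inner (a *: u) x = a * inner u x.
Proof. by rewrite innerC innerZr innerC. Qed.

Lemma innerNl u x : inner (- u) x = - inner u x.
Proof. by rewrite innerC innerNr innerC. Qed.

Lemma innerBl u v x : inner (u - v) x = inner u x - inner v x.
Proof. by rewrite innerDl innerNl. Qed.

Lemma inner_ge0 x : 0 <= inner x x.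
Proof. by apply: sumr_ge0 => i _; rewrite -expr2 sqr_ge0. Qed.

Lemma inner_eq0 x : (inner x x == 0) = (x == 0).
Proof.
apply/idP/eqP => [|->]; last by rewrite inner0r.
rewrite psumr_eq0 => [/allP h|i _]; last by rewrite -expr2 sqr_ge0.
apply/rowP => i; rewrite mxE; apply/eqP.
by have := h i (mem_index_enum i); rewrite /= mulf_eq0 orbb.
Qed.

Lemma inner_gt0 x : (0 < inner x x) = (x != 0).
Proof. by rewrite lt_def inner_ge0 andbT inner_eq0. Qed.

End Inner.

Section ConvexHull.
Variables (R : realType) (n : nat).
Implicit Types (A B : set 'rV[R]_n) (x y : 'rV[R]_n).

Lemma convex_setE A :
  convex_set (A : set (convex_lmodType 'rV[R]_n)) <->
  forall x y (t : R), 0 <= t <= 1 -> A x -> A y -> A (t *: x + (1 - t) *: y).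
Proof.
split=> [cA x y t /andP[t0 t1] Ax Ay|cA x y t /set_mem Ax /set_mem Ay].
  exact/set_mem/(cA x y (Itv01 t0 t1) (mem_set Ax) (mem_set Ay)).
by apply/mem_set/cA => //; rewrite ge0 le1.
Qed.

Lemma convex_hull_convex A x y (t : R) : 0 <= t <= 1 ->
  convex_hull A x -> convex_hull A y -> convex_hull A (t *: x + (1 - t) *: y).
Proof.
move=> t01 Ax Ay B [cB AB].
by apply: ((convex_setE B).1 cB) => //; [exact: Ax|exact: Ay].
Qed.

Lemma sub_convex_hull A : A `<=` convex_hull A.
Proof. exact: sub_smallest. Qed.

Lemma convex_hull_min A B :
  convex_set (B : set (convex_lmodType 'rV[R]_n)) -> A `<=` B ->
  convex_hull A `<=` B.
Proof. by move=> cB AB; apply: smallest_sub. Qed.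

Lemma convex_halfspace u (c : R) :
  convex_set ([set x | inner u x <= c] : set (convex_lmodType 'rV[R]_n)).
Proof.
apply: (convex_setE _).2 => x y t /andP[t0 t1] /= xc yc.
rewrite innerDr !innerZr; nra.
Qed.

End ConvexHull.

(** * Polyhedra, tight constraints and vertices *)

Section HPolyhedron.
Variables (R : realType) (n : nat) (I : finType).
Variables (u : I -> 'rV[R]_n) (g : I -> R).
Implicit Types (x y z : 'rV[R]_n) (A : {set I}).

Definition hpoly : set 'rV[R]_n := [set x | forall i, inner (u i) x <= g i].

Definition tight x : {set I} := [set i | inner (u i) x == g i]%SET.

Definition spanning A :=
  forall z, (forall i, i \in A -> inner (u i) z = 0) -> z = 0.

(** The recession cone is trivial: for a nonempty polyhedron this is boundedness, in a form that
    does not depend on [g]. *)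
Definition no_recession :=
  forall z, (forall i, inner (u i) z <= 0) -> z = 0.

Definition vertex x := hpoly x /\ spanning (tight x).

Lemma tightP i x : reflect (inner (u i) x = g i) (i \in tight x).
Proof. by rewrite inE; exact: eqP. Qed.

Lemma hpoly_convex :
  convex_set (hpoly : set (convex_lmodType 'rV[R]_n)).
Proof.
apply: (convex_setE _).2 => x y t t01 Px Py i.
exact: ((convex_setE _).1 (@convex_halfspace _ _ (u i) (g i))) t01 (Px i) (Py i).
Qed.

Lemma orthogonal_card_lt A : (#|A| < n)%N ->
  exists2 z, z != 0 & forall i, i \in A -> inner (u i) z = 0.
Proof.
move=> An; pose M := \matrix_(a < n, b < #|A|) u (enum_val b) 0 a.
have kM : kermx M != 0.
  by rewrite -mxrank_eq0 mxrank_ker subn_eq0 -ltnNge (leq_ltn_trans (rank_leq_col _)).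
exists (nz_row (kermx M)); first by rewrite nz_row_eq0.
move=> i iA; have /sub_kermxP/rowP/(_ (enum_rank_in iA i)) := nz_row_sub (kermx M).
rewrite !mxE => {1}<-; apply: eq_bigr => j _.
by rewrite mxE enum_rankK_in // mulrC.
Qed.

Lemma vertex_card x : vertex x -> (n <= #|tight x|)%N.
Proof.
move=> [_ sx]; rewrite leqNgt; apply/negP => /orthogonal_card_lt[z /eqP z0 zT].
exact: z0 (sx _ zT).
Qed.

Lemma vertex_inj x y : vertex x -> tight x = tight y -> x = y.
Proof.
move=> [_ sx] xy; apply/eqP; rewrite -subr_eq0; apply/eqP; apply: sx => i ix.
have /tightP yi : i \in tight y by rewrite -xy.
by move/tightP: ix => xi; rewrite innerBr xi yi subrr.
Qed.

Lemma finite_vertex : finite_set [set x | vertex x].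
Proof.
apply: (card_le_finite _ (finite_finset (X := [set: {set I}]))).
apply: (@card_le_inj _ _ tight) => // x y /set_mem vx _; exact: vertex_inj.
Qed.

(** This is the ratio test of the simplex method: [t] is the largest step along [z] that violates no
    constraint. *)
Lemma hpoly_step x z : hpoly x -> (exists j, 0 < inner (u j) z) ->
  (forall i, i \in tight x -> inner (u i) z <= 0) ->
  exists2 t : R, 0 < t & hpoly (x + t *: z) /\
    exists2 j, 0 < inner (u j) z & j \in tight (x + t *: z).
Proof.
move=> Px [j0 j0z] Tz.
pose F j := (g j - inner (u j) x) / inner (u j) z.
have [j jz jmin] := @arg_minP _ _ _ j0 (fun j => 0 < inner (u j) z) F j0z.
have Fj0 : 0 < F j.
  rewrite divr_gt0 // subr_gt0 lt_neqAle Px andbT; apply/negP => jT.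
  by have := Tz j; rewrite inE => /(_ jT); rewrite leNgt jz.
exists (F j) => //; split; last first.
  by exists j => //; rewrite inE innerDr innerZr /F divfK ?lt0r_neq0 // addrC subrK.
move=> i; rewrite innerDr innerZr.
have [iz|iz] := leP (inner (u i) z) 0.
  by rewrite -[leRHS]addr0 lerD // mulr_ge0_le0 // ltW.
by rewrite addrC -lerBrDr -ler_pdivlMr //; exact: jmin.
Qed.

Hypothesis norec : no_recession.

Lemma exists_inner_gt0 z : z != 0 -> exists j, 0 < inner (u j) z.
Proof.
move=> z0; apply: contrapT => h; move/eqP: z0; apply; apply: norec => i.
by rewrite leNgt; apply/negP => iz; apply: h; exists i.
Qed.

Lemma orthogonal_step x z : hpoly x -> z != 0 ->
  (forall i, i \in tight x -> inner (u i) z = 0) ->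
  exists2 t : R, 0 < t & hpoly (x + t *: z) /\ tight x \proper tight (x + t *: z).
Proof.
move=> Px z0 Tz.
have [|t t0 [Pt [j jz jT]]] := hpoly_step Px (exists_inner_gt0 z0); first by move=> i /Tz ->.
exists t => //; split => //; apply/properP; split.
  apply/fintype.subsetP => i ix; apply/tightP; rewrite innerDr innerZr Tz // mulr0 addr0.
  exact/tightP.
by exists j => //; apply/negP => /Tz jz0; rewrite jz0 ltxx in jz.
Qed.

Lemma not_spanning x : ~ spanning (tight x) ->
  exists2 z, z != 0 & forall i, i \in tight x -> inner (u i) z = 0.
Proof.
move=> h; apply: contrapT => h2; apply: h => z zT; apply: contrapT => /eqP z0.
by apply: h2; exists z.
Qed.

(** While the tight normals do not span, a step orthogonal to them keeps the tight constraints and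
    adds a new one; the sign of [z] is chosen so that [inner c] does not decrease. The induction is
    on the number of constraints that are not tight. *)
Lemma vertex_ge c x : hpoly x ->
  exists2 v, vertex v & tight x \subset tight v /\ inner c x <= inner c v.
Proof.
have [m] := ubnP #|~: tight x|%SET; elim: m x => // m IH x xm Px.
have [sx|/not_spanning[z z0 zT]] := pselect (spanning (tight x)).
  by exists x.
wlog cz : z z0 zT / 0 <= inner c z.
  move=> W; have [cz|cz] := leP 0 (inner c z); first exact: W cz.
  apply: (W (- z)); rewrite ?oppr_eq0 ?innerNr ?oppr_ge0 ?ltW // => i iT.
  by rewrite innerNr zT ?oppr0.
have [t t0 [Pt pT]] := orthogonal_step Px z0 zT.
have [|v vv [Tv cv]] := IH (x + t *: z) _ Pt.
  apply: leq_trans (_ : _ <= #|~: tight x|%SET)%N _; last by rewrite -ltnS.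
  apply: proper_card.
  by rewrite properE !finset.setCS -properE.
exists v => //; split; first exact: fintype.subset_trans (proper_sub pT) Tv.
by apply: le_trans cv; rewrite innerDr innerZr lerDl mulr_ge0 // ltW.
Qed.

(** A point that is not a vertex lies on a segment whose two ends have more tight constraints, found
    by steps along [z] and [- z]. *)
Lemma hpoly_hull : hpoly = convex_hull [set x | vertex x].
Proof.
apply/seteqP; split; last first.
  by apply: convex_hull_min => [|x []] //; exact: hpoly_convex.
move=> x; have [m] := ubnP #|~: tight x|%SET; elim: m x => // m IH x xm Px.
have [sx|/not_spanning[z z0 zT]] := pselect (spanning (tight x)).
  exact: sub_convex_hull.
have [t t0 [Pt pT]] := orthogonal_step Px z0 zT.
have [||s s0 [Ps pS]] := @orthogonal_step x (- z) Px.
- by rewrite oppr_eq0.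
- by move=> i iT; rewrite innerNr zT ?oppr0.
have st : 0 < s + t by rewrite addr_gt0.
have -> : x = (s / (s + t)) *: (x + t *: z) + (1 - s / (s + t)) *: (x + s *: - z).
  apply/rowP => i; rewrite !mxE.
  by field; rewrite lt0r_neq0.
apply: convex_hull_convex.
- by apply/andP; split; [rewrite divr_ge0 ?ltW|rewrite ler_pdivrMr // mul1r lerDl ltW].
- apply: IH => //; apply: leq_trans (_ : _ <= #|~: tight x|%SET)%N _; last by rewrite -ltnS.
  apply: proper_card.
  by rewrite properE !finset.setCS -properE.
- apply: IH => //; apply: leq_trans (_ : _ <= #|~: tight x|%SET)%N _; last by rewrite -ltnS.
  apply: proper_card.
  by rewrite properE !finset.setCS -properE.
Qed.

End HPolyhedron.

(** * Moving in a polyhedron away from a vertex *)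

Lemma card_setU_seq (I : finType) (A B : {set I}) (s : seq I) :
  uniq s -> (forall i, i \in s -> i \in B /\ i \notin A) ->
  (#|A| + size s <= #|A :|: B|%SET)%N.
Proof.
move=> us sAB; rewrite -(cardsID A (A :|: B)%SET); apply: leq_add.
  by apply/subset_leq_card/fintype.subsetP => i iA; rewrite !inE iA.
rewrite -(card_uniqP us); apply/subset_leq_card/fintype.subsetP => i /sAB[iB iA].
by rewrite !inE iB orbT andbT; move: iA; rewrite ?inE.
Qed.

Section BigMax.
Variables (R : realType) (I : finType).

Lemma continuous_bigmax (f0 : R -> R) (f : I -> R -> R) (r : seq I) (P : pred I) :
  continuous f0 -> (forall i, continuous (f i)) ->
  continuous (fun t => \big[Num.max/f0 t]_(i <- r | P i) f i t).
Proof.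
move=> f0c fc; elim: r => [|i r IH] t.
  by under eq_fun do rewrite big_nil; exact: f0c.
under eq_fun do rewrite big_cons.
case: (P i); last exact: IH.
by apply: continuous_max; [exact: fc|exact: IH].
Qed.

End BigMax.

Section Exit.
Variables (R : realType) (n : nat) (I : finType).
Variables (u : I -> 'rV[R]_n) (g : I -> R).
Implicit Types (v x y z : 'rV[R]_n) (A B : {set I}).
Local Notation P := (hpoly u g).
Local Notation T := (tight u g).

(* The ray from [v] through [z] leaves [P] at [v + r^-1 *: (z - v)], where [r] is the largest
   [ratio v i z] over the constraints [i] that are not tight at [v]. *)
Definition ratio v i z := inner (u i) (z - v) / (g i - inner (u i) v).

Lemma ratio_conv v i x y (t : R) :
  ratio v i (t *: x + (1 - t) *: y) = t * ratio v i x + (1 - t) * ratio v i y.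
Proof. by rewrite /ratio !innerBr innerDr !innerZr; ring. Qed.

Lemma slack_gt0 v i : P v -> i \notin T v -> 0 < g i - inner (u i) v.
Proof. by move=> Pv iv; rewrite subr_gt0 lt_neqAle Pv andbT; move: iv; rewrite inE. Qed.

Lemma ratio_leE v i z : P v -> i \notin T v -> (ratio v i z <= 1) = (inner (u i) z <= g i).
Proof.
by move=> Pv iv; rewrite ler_pdivrMr ?slack_gt0 // mul1r innerBr lerD2r.
Qed.

Lemma ratio_le1 v i z : P v -> i \notin T v -> P z -> ratio v i z <= 1.
Proof. by move=> Pv iv Pz; rewrite ratio_leE. Qed.

Lemma ratio_eq1 v i z : P v -> i \notin T v -> (ratio v i z == 1) = (i \in T z).
Proof.
move=> Pv iv; have s0 := slack_gt0 Pv iv.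
by rewrite inE -(inj_eq (mulIf (lt0r_neq0 s0))) divfK ?lt0r_neq0 // mul1r innerBr
  (inj_eq (addIr _)).
Qed.

Lemma vertex_extreme v x y (t : R) : vertex u g v -> P x -> P y -> 0 <= t <= 1 ->
  x != v -> y != v -> t *: x + (1 - t) *: y != v.
Proof.
move=> [Pv sv] Px Py /andP[t0 t1] xv yv; apply/eqP => E.
have [t00|tn0] := eqVneq t 0.
  by move: E yv; rewrite t00 scale0r add0r subr0 scale1r => ->; rewrite eqxx.
case/negP: xv; rewrite -subr_eq0; apply/eqP/sv => i iv; apply/eqP.
rewrite innerBr (tightP _ _ _ _ iv) subr_eq0 eq_le Px /=.
have := tightP _ _ _ _ iv; rewrite -E innerDr !innerZr => iE.
have tp : 0 < t by rewrite lt_def tn0.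
have := Py i; have := Px i; nra.
Qed.

Hypothesis norec : no_recession u.

(** All constraints of maximal ratio become tight together where the ray leaves [P]. The maximum is
    positive because, without recession directions, some constraint increases along the ray. *)
Lemma exit_point v z : P v -> P z -> z != v ->
  exists2 p, P p & forall i, i \notin T v ->
    (forall j, j \notin T v -> ratio v j z <= ratio v i z) -> i \in T p.
Proof.
move=> Pv Pz zv.
have [j0 j0z] : exists j, 0 < inner (u j) (z - v) by apply: exists_inner_gt0; rewrite ?subr_eq0.
have j0v : j0 \notin T v.
  apply/negP => /tightP jv; move: j0z; rewrite innerBr jv subr_gt0.
  by rewrite ltNge Pz.
have [j jv jmax] := @arg_maxP _ _ _ j0 (fun j => j \notin T v) (ratio v ^~ z) j0v.
set r := ratio v j z in jmax.
have r0 : 0 < r.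
  by apply: lt_le_trans (jmax _ j0v); rewrite divr_gt0 // slack_gt0.
have ratioP i : ratio v i (v + r^-1 *: (z - v)) = r^-1 * ratio v i z.
  by rewrite /ratio addrC addKr innerZr mulrA.
exists (v + r^-1 *: (z - v)) => i.
  have [/tightP iv|iv] := boolP (i \in T v).
    rewrite innerDr innerZr iv -[leRHS]addr0 lerD2l mulr_ge0_le0 ?invr_ge0 ?(ltW r0) //.
    by rewrite innerBr iv subr_le0 Pz.
  by rewrite -(ratio_leE _ Pv iv) ratioP mulrC ler_pdivrMr // mul1r; exact: jmax.
move=> iv imax; rewrite -(ratio_eq1 _ Pv iv) ratioP.
have -> : ratio v i z = r by apply/eqP; rewrite eq_le imax // andbT; exact: jmax.
by rewrite mulVf // lt0r_neq0.
Qed.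

(** Along a segment from a point on the face of [b] to one on the face of [a], the largest ratios
    over [A] and over [B] vary continuously. Each equals 1 at its own end, where the other is at
    most 1, so they agree somewhere; the ray through that point leaves [P] on a face of [A] and a
    face of [B] at once. *)
Lemma far_connected v A B : vertex u g v ->
  (forall i, i \notin T v -> exists2 x, P x & i \in T x) ->
  (forall i, i \notin T v -> i \in A \/ i \in B) ->
  (forall i, i \in A -> i \notin T v) -> (forall i, i \in B -> i \notin T v) ->
  A != finset.set0 -> B != finset.set0 ->
  exists i j p, [/\ i \in A, j \in B & P p] /\ i \in T p /\ j \in T p.
Proof.
move=> vv hit AB Av Bv /set0Pn[a aA] /set0Pn[b bB]; have [Pv _] := vv.
have [x Px ax] := hit a (Av _ aA); have [y Py bY] := hit b (Bv _ bB).
have xv : x != v by apply: contraL ax => /eqP ->; exact: Av.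
have yv : y != v by apply: contraL bY => /eqP ->; exact: Bv.
pose L (t : R) := t *: x + (1 - t) *: y.
pose mA (t : R) := \big[Num.max/ratio v a (L t)]_(i in A) ratio v i (L t).
pose mB (t : R) := \big[Num.max/ratio v b (L t)]_(i in B) ratio v i (L t).
have cr i : continuous (fun t => ratio v i (L t)).
  move=> t; under eq_fun do rewrite ratio_conv.
  apply: cvgD; first by apply: cvgMr_tmp; exact: cvg_id.
  by apply: cvgMr_tmp; apply: cvgB; [exact: cvg_cst|exact: cvg_id].
have cA : continuous mA by apply: continuous_bigmax.
have cB : continuous mB by apply: continuous_bigmax.
have L1 : L 1 = x by rewrite /L scale1r subrr scale0r addr0.
have L0 : L 0 = y by rewrite /L scale0r subr0 scale1r add0r.
have mA1 : mA 1 = 1.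
  apply/eqP; rewrite eq_le; apply/andP; split.
    by apply: bigmax_le => [|i iA]; rewrite L1 ratio_le1 // Av.
  apply: le_trans (_ : ratio v a (L 1) <= _); last exact: bigmax_ge_id.
  by rewrite L1; have /eqP -> : ratio v a x == 1 by rewrite ratio_eq1 // Av.
have mB0 : mB 0 = 1.
  apply/eqP; rewrite eq_le; apply/andP; split.
    by apply: bigmax_le => [|i iB]; rewrite L0 ratio_le1 // Bv.
  apply: le_trans (_ : ratio v b (L 0) <= _); last exact: bigmax_ge_id.
  by rewrite L0; have /eqP -> : ratio v b y == 1 by rewrite ratio_eq1 // Bv.
have mA0 : mA 0 <= 1 by apply: bigmax_le => [|i iA]; rewrite L0 ratio_le1 // Av.
have mB1 : mB 1 <= 1 by apply: bigmax_le => [|i iB]; rewrite L1 ratio_le1 // Bv.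
have [||t] := @IVT R (fun t => mA t - mB t) 0 1 0 ler01.
- by apply: continuous_subspaceT => t; apply: cvgB; [exact: cA|exact: cB].
- rewrite mA1 mB0 ge_min le_max !subr_le0 !subr_ge0 mA0 mB1 orbT //.
rewrite in_itv /= => t01 /eqP; rewrite subr_eq0 => /eqP mAB.
have PL : P (L t) by apply: ((convex_setE _).1 (@hpoly_convex _ _ _ u g)).
have [p Pp pT] := exit_point Pv PL (vertex_extreme vv Px Py t01 xv yv).
have [i iA iE] : exists2 i, i \in A & ratio v i (L t) = mA t.
  apply: (big_ind (fun m => exists2 i, i \in A & ratio v i (L t) = m)) => //.
  - by exists a.
  - by move=> m1 m2 h1 h2; rewrite maxEle; case: ifP.
  - by move=> i iA; exists i.
have [j jB jE] : exists2 j, j \in B & ratio v j (L t) = mB t.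
  apply: (big_ind (fun m => exists2 i, i \in B & ratio v i (L t) = m)) => //.
  - by exists b.
  - by move=> m1 m2 h1 h2; rewrite maxEle; case: ifP.
  - by move=> l lB; exists l.
have all_le l : l \notin T v -> ratio v l (L t) <= mA t.
  move=> /AB[lA|lB]; first exact: (@le_bigmax_cond _ _ _ _ l).
  by rewrite mAB; exact: (@le_bigmax_cond _ _ _ _ l).
exists i, j, p; split; first by split.
split; apply: pT; [exact: Av| |exact: Bv|] => l /all_le; first by rewrite iE.
by rewrite jE -mAB.
Qed.

(** The three ratios are affine on the triangle of the given points, and each is 1 at two corners. A
    point where they coincide is projected from [v] to the boundary. *)
Lemma far_triangle v a b c xab xbc xac : vertex u g v ->
  a \notin T v -> b \notin T v -> c \notin T v ->
  (forall i, i \notin T v -> [\/ i = a, i = b | i = c]) ->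
  P xab -> P xbc -> P xac ->
  a \in T xab -> b \in T xab -> b \in T xbc -> c \in T xbc ->
  a \in T xac -> c \in T xac ->
  exists2 p, P p & [/\ a \in T p, b \in T p & c \in T p].
Proof.
move=> vv av bv cv abc Pab Pbc Pac aab bab bbc cbc aac cac.
have Pv := vv.1.
have neqv i x : i \notin T v -> i \in T x -> x != v.
  by move=> iv; apply: contraL => /eqP ->.
have r1 i x : i \notin T v -> i \in T x -> ratio v i x = 1.
  by move=> iv ix; apply/eqP; rewrite ratio_eq1.
have [cab|cab] := boolP (c \in T xab); first by exists xab.
have [abc'|abc'] := boolP (a \in T xbc); first by exists xbc.
have [bac|bac] := boolP (b \in T xac); first by exists xac.
have lt1 i x : i \notin T v -> P x -> i \notin T x -> 0 < 1 - ratio v i x.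
  by move=> iv Px ix; rewrite subr_gt0 lt_neqAle ratio_le1 // ratio_eq1 // ix.
have := lt1 _ _ cv Pab cab; have := lt1 _ _ av Pbc abc'; have := lt1 _ _ bv Pac bac.
set al := 1 - ratio v a xbc; set be := 1 - ratio v b xac; set ga := 1 - ratio v c xab.
move=> be0 al0 ga0.
(* The corners [xbc], [xac], [xab] get weights proportional to the inverses of [al], [be], [ga], so
   that each ratio drops from 1 by the same amount. *)
pose t := be / (be + al); pose s := al * be / (al * be + be * ga + al * ga).
have D0 : 0 < al * be + be * ga + al * ga by rewrite !addr_gt0 ?mulr_gt0.
have E0 : 0 < be + al by rewrite addr_gt0.
have t01 : 0 <= t <= 1.
  apply/andP; split; first by rewrite divr_ge0 ?ltW.
  by rewrite ler_pdivrMr // mul1r lerDl ltW.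
have s01 : 0 <= s <= 1.
  apply/andP; split; first by rewrite divr_ge0 ?ltW ?mulr_gt0.
  by rewrite ler_pdivrMr // mul1r -addrA lerDl addr_ge0 ?ltW ?mulr_gt0.
have cP := (convex_setE _).1 (@hpoly_convex _ _ _ u g).
pose y := t *: xbc + (1 - t) *: xac; pose z := s *: xab + (1 - s) *: y.
have Py : P y by apply: cP.
have Pz : P z by apply: cP.
have yv : y != v by apply: vertex_extreme => //; [exact: neqv cbc|exact: neqv cac].
have zv : z != v by apply: vertex_extreme => //; exact: neqv aab.
have [p Pp pT] := exit_point Pv Pz zv.
pose r := 1 - al * be * ga / (al * be + be * ga + al * ga).
have ra : ratio v a z = r.
  rewrite !ratio_conv (r1 _ _ av aab) (r1 _ _ av aac).
  have -> : ratio v a xbc = 1 - al by rewrite /al; ring.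
  rewrite /r /s /t; field; rewrite !lt0r_neq0 //.
have rb : ratio v b z = r.
  rewrite !ratio_conv (r1 _ _ bv bab) (r1 _ _ bv bbc).
  have -> : ratio v b xac = 1 - be by rewrite /be; ring.
  rewrite /r /s /t; field; rewrite !lt0r_neq0 //.
have rc : ratio v c z = r.
  rewrite !ratio_conv (r1 _ _ cv cbc) (r1 _ _ cv cac).
  have -> : ratio v c xab = 1 - ga by rewrite /ga; ring.
  rewrite /r /s /t; field; rewrite !lt0r_neq0 //.
exists p => //; split; apply: pT => // j /abc[]->; by rewrite ?ra ?rb ?rc.
Qed.

(* Two points of [P] on the ray leaving [v] along the constraints [T v :\ p]. *)
Lemma ray_meet v x y p l l' : vertex u g v -> P x -> P y ->
  T v :\ p \subset T x -> T v :\ p \subset T y ->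
  l \notin T v -> l' \notin T v -> l \in T x -> l' \in T y ->
  exists2 w, P w & l \in T w /\ l' \in T w.
Proof.
move=> vv; have [Pv sv] := vv.
wlog : x y l l' / - inner (u p) (x - v) <= - inner (u p) (y - v).
  move=> W Px Py Tx Ty lv l'v lx l'y.
  have [xy|/ltW yx] := leP (- inner (u p) (x - v)) (- inner (u p) (y - v)).
    exact: (W x y).
  by have [w Pw []] := W y x l' l yx Py Px Ty Tx l'v lv l'y lx; exists w.
have pos i z : P z -> T v :\ p \subset T z -> i \notin T v -> i \in T z ->
    0 < - inner (u p) (z - v).
  move=> Pz Tz iv iz; rewrite oppr_gt0 ltNge; apply/negP => h.
  suff zv : z = v by rewrite zv (negPf iv) in iz.
  apply/eqP; rewrite -subr_eq0; apply/eqP/sv => j jv.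
  have [jp|jp] := eqVneq j p.
    apply/eqP; rewrite eq_le jp h andbT innerBr subr_le0.
    by rewrite -jp (tightP _ _ _ _ jv) Pz.
  have jz : j \in T z by apply: (fintype.subsetP Tz); rewrite !inE jp; move: jv; rewrite inE.
  by rewrite innerBr (tightP _ _ _ _ jv) (tightP _ _ _ _ jz) subrr.
move=> xy Px Py Tx Ty lv l'v lx l'y.
have a0 := pos _ _ Px Tx lv lx; have b0 := pos _ _ Py Ty l'v l'y.
move: xy a0 b0; set a := - _; set b := - _ => ab a0 b0.
(* Both displacements are orthogonal to the normals of [T v :\ p], so they are parallel; their
   values along [u p] give the factors. *)
have E : b *: (x - v) = a *: (y - v).
  apply/eqP; rewrite -subr_eq0; apply/eqP/sv => j jv.
  rewrite innerBr !innerZr.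
  have [->|jp] := eqVneq j p; first by rewrite /a /b; ring.
  have jx : j \in T x by apply: (fintype.subsetP Tx); rewrite !inE jp; move: jv; rewrite inE.
  have jy : j \in T y by apply: (fintype.subsetP Ty); rewrite !inE jp; move: jv; rewrite inE.
  rewrite !innerBr (tightP _ _ _ _ jv) (tightP _ _ _ _ jx) (tightP _ _ _ _ jy).
  by rewrite subrr !mulr0 subrr.
have EI i : b * (inner (u i) x - inner (u i) v) = a * (inner (u i) y - inner (u i) v).
  by rewrite -!innerBr -!innerZr E.
(* [y] is at least as far out as [x], where [l] is already tight, so feasibility of [y] forces [l]
   to be tight there too. *)
exists y => //; split=> //; apply/tightP/eqP; rewrite eq_le Py /=.
have := EI l; rewrite (tightP _ _ _ _ lx).
have := slack_gt0 Pv lv; have := Py l; nra.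
Qed.

(** Since [T w :\ q] has fewer than [n] elements, it leaves a direction [z] along which [q] becomes
    slack: an edge at [w], with [w'] as its other end. *)
Lemma vertex_drop w q : (#|T w| <= n)%N -> vertex u g w -> q \in T w ->
  exists2 w', vertex u g w' & T w :\ q \subset T w' /\ q \notin T w'.
Proof.
move=> wn [Pw sw] qw.
have [|z z0 zT] := @orthogonal_card_lt _ _ _ u (T w :\ q).
  by apply: leq_trans wn; rewrite [leqRHS](cardsD1 q) qw.
wlog qz : z z0 zT / inner (u q) z < 0.
  move=> W; have [||qz] := ltrgt0P (inner (u q) z); last 2 first.
  - exact: W.
  - case/eqP: z0; apply: sw => i iw; have [->//|iq] := eqVneq i q.
    by apply: zT; rewrite !inE iq; move: iw; rewrite inE.
  move=> qz; apply: (W (- z)); rewrite ?oppr_eq0 ?innerNr ?oppr_lt0 // => i iT.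
  by rewrite innerNr zT ?oppr0.
have [|t t0 [Pt [j jz jT]]] := hpoly_step Pw (exists_inner_gt0 norec z0).
  move=> i iw; have [->|iq] := eqVneq i q; first exact: ltW.
  by rewrite zT // !inE iq; move: iw; rewrite inE.
have sub : T w :\ q \subset T (w + t *: z).
  apply/fintype.subsetP => i iT; apply/tightP; rewrite innerDr innerZr zT // mulr0 addr0.
  by apply/tightP; move: iT; rewrite in_setD1 => /andP[].
exists (w + t *: z); last first.
  split => //; apply/negP => /tightP; rewrite innerDr innerZr (tightP _ _ _ _ qw).
  by apply/eqP; rewrite lt_eqF // gtrDl pmulr_rlt0.
split => // y yT.
(* As [T w] spans, [y] is a multiple of [z]; the constraint [j] gained at the new point is not
   orthogonal to [z], so [y] vanishes. *)
have E : inner (u q) z *: y = inner (u q) y *: z.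
  apply/eqP; rewrite -subr_eq0; apply/eqP/sw => i iw.
  rewrite innerBr !innerZr; have [->|iq] := eqVneq i q; first by ring.
  have iT : i \in T w :\ q by rewrite in_setD1 iq.
  by rewrite (zT i iT) (yT i) ?(fintype.subsetP sub) // !mulr0 subrr.
have /eqP : inner (u q) y * inner (u j) z = 0.
  by rewrite -innerZr -E innerZr yT // mulr0.
rewrite mulf_eq0 (gt_eqF jz) orbF => /eqP qy.
have /eqP := E; rewrite qy scale0r scaler_eq0 (lt_eqF qz) /= => /eqP //.
Qed.

End Exit.

(** * Hitting all faces with few points *)

Lemma leq_card_exchange (I : finType) (A B C : {set I}) :
  (#|A| <= #|B|)%N -> B \subset (A :&: B) :|: C -> (#|A :\: B| <= #|C|)%N.
Proof.
move=> AB sub; have := cardsID B A.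
have := leq_trans (subset_leq_card sub) (leq_card_setU _ _); lia.
Qed.

Lemma card_setD_lt (I : finType) (A B : {set I}) :
  (#|A :\: B| < #|A|)%N -> exists x, x \in A :&: B.
Proof. by move=> lt; apply/set0Pn; rewrite -card_gt0; have := cardsID B A; lia. Qed.

(** * Simple polytopes in which two or three points never save enough *)

Section SimplePolytope.
Variables (R : realType) (n : nat) (I : finType).
Variables (u : I -> 'rV[R]_n) (g : I -> R).
Local Notation P := (hpoly u g).
Local Notation T := (tight u g).
Hypothesis norec : no_recession u.
Hypothesis hit : forall i, exists2 x, P x & i \in T x.
Hypothesis simple : forall v, vertex u g v -> (#|T v| <= n)%N.

Definition adjacent i j := exists2 x, P x & i \in T x /\ j \in T x.

Lemma adjacentC i j : adjacent i j -> adjacent j i.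
Proof. by case=> x Px [ix jx]; exists x. Qed.

(** Among at most [n + k + 1] faces, two points meeting [n + 3] of them, or three points meeting
    [n + 4], could be completed by one point for each other face to at most [k] points. Both savings
    are excluded here. *)
Hypothesis no_pair : forall w w', P w -> P w' -> ~ (n + 3 <= #|T w :|: T w'|)%N.
Hypothesis no_triple : forall w w' w'', P w -> P w' -> P w'' ->
  ~ (n + 4 <= #|T w :|: T w' :|: T w''|)%N.

Section AtVertex.
Variable v : 'rV[R]_n.
Hypothesis vv : vertex u g v.

Lemma card_above (B : {set I}) (s : seq I) : T v \subset B ->
  uniq s -> all (fun i => i \in B) s -> all (fun i => i \notin T v) s ->
  (n + size s <= #|B|)%N.
Proof.
move=> vB us /allP sB /allP sv; have /finset.setUidPr <- := vB.
apply: leq_trans (card_setU_seq (A := T v) us _); first by rewrite leq_add2r vertex_card.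
by move=> i si; split; [exact: sB|exact: sv].
Qed.

Lemma no_far_triple i j l w : P w -> uniq [:: i; j; l] ->
  i \notin T v -> j \notin T v -> l \notin T v ->
  i \in T w -> j \in T w -> ~ l \in T w.
Proof.
move=> Pw us iv jv lv iw jw lw; apply: (no_pair vv.1 Pw).
apply: (@card_above _ [:: i; j; l]) => //; first exact: finset.subsetUl.
  by rewrite /= !finset.in_setU iw jw lw !orbT.
by rewrite /= iv jv lv.
Qed.

(** [v] and one point on each of two disjoint edges would meet [n + 4] faces. *)
Lemma no_far_matching i j k l : uniq [:: i; j; k; l] ->
  i \notin T v -> j \notin T v -> k \notin T v -> l \notin T v ->
  adjacent i j -> ~ adjacent k l.
Proof.
move=> us iv jv kv lv [x Px [ix jx]] [y Py [ky ly]].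
apply: (no_triple vv.1 Px Py); apply: (@card_above _ [:: i; j; k; l]) => //.
- by rewrite -finset.setUA finset.subsetUl.
- by rewrite /= !finset.in_setU ix jx ky ly !orbT.
- by rewrite /= iv jv kv lv.
Qed.

Lemma far_edge a d : a \notin T v -> d \notin T v -> d != a ->
  exists j, [/\ j \notin T v, j != a & adjacent a j].
Proof.
move=> av dv da.
have [||||||i [j [p [[/finset.set1P -> jB Pp] [ip jp]]]]] :=
  @far_connected _ _ _ u g norec v [set a]%SET (~: T v :\ a)%SET vv.
- by move=> i _; exact: hit.
- move=> i iv; rewrite finset.in_set1 in_setD1 finset.in_setC iv andbT.
  by case: (i == a); [left|right].
- by move=> i /finset.set1P ->.
- by move=> i; rewrite in_setD1 finset.in_setC => /andP[].
- by apply/set0Pn; exists a; rewrite finset.in_set1.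
- by apply/set0Pn; exists d; rewrite in_setD1 finset.in_setC da.
move: jB; rewrite in_setD1 finset.in_setC => /andP[ja jv].
by exists j; split => //; exists p.
Qed.

Lemma far_edge2 a b d : a \notin T v -> b \notin T v -> d \notin T v ->
  d != a -> d != b ->
  exists c j, [/\ c = a \/ c = b, j \notin T v, j != a, j != b & adjacent c j].
Proof.
move=> av bv dv da db.
have [||||||i [j [p [[iA jB Pp] [ip jp]]]]] :=
  @far_connected _ _ _ u g norec v [set a; b]%SET (~: T v :\ a :\ b)%SET vv.
- by move=> i _; exact: hit.
- move=> i iv; rewrite finset.in_set2 !in_setD1 finset.in_setC iv andbT.
  by case: (i == a); case: (i == b); [left|left|left|right].
- by move=> i /finset.set2P[]->.
- by move=> i; rewrite !in_setD1 finset.in_setC => /and3P[].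
- by apply/set0Pn; exists a; rewrite finset.in_set2 eqxx.
- by apply/set0Pn; exists d; rewrite !in_setD1 finset.in_setC da db.
move: jB; rewrite !in_setD1 finset.in_setC => /and3P[jb ja jv].
exists i, j; split => //; last by exists p.
by apply/finset.set2P.
Qed.

Section Star.
Variable c : I.
Hypothesis cv : c \notin T v.

(* The edge of [v] obtained by dropping [p] ends in the facet [l]. *)
Definition exits_to l p := p \in T v /\ exists2 y, P y & T v :\ p \subset T y /\ l \in T y.

Lemma exits_to_inj l l' p : l \notin T v -> l' \notin T v -> ~ adjacent l l' ->
  exits_to l p -> ~ exits_to l' p.
Proof.
move=> lv l'v ll' [pv [x Px [Tx lx]]] [_ [y Py [Ty ly]]]; apply: ll'.
exact: (ray_meet vv Px Py Tx Ty).
Qed.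

(** No third far face passes through [w], so all but at most two elements of [T w] are in [T v],
    while [T w] is at least as large as [T v]. *)
Lemma star_vertex_card l w : l \notin T v -> l != c ->
  vertex u g w -> c \in T w -> l \in T w -> (#|T v :\: T w| <= 2)%N.
Proof.
move=> lv lc vw cw lw.
have sub : T w \subset (T v :&: T w) :|: [set c; l].
  apply/fintype.subsetP => i iw; rewrite finset.in_setU finset.in_setI finset.in_set2 iw andbT.
  apply/orP; case: (boolP (i \in T v)) => iv; [by left|right].
  apply/negPn/negP; rewrite negb_or => /andP[ic il].
  apply: (@no_far_triple i c l w) => //; first exact: vw.1.
  by rewrite /= !inE negb_or ic il eq_sym lc.
have := leq_card_exchange (leq_trans (simple vv) (vertex_card vw)) sub.
by rewrite cards2 eq_sym lc.
Qed.

(** Leaving the face of [c] from [w] along an edge in the face of [l] leads to a vertex [w3] at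
    which [l] is the only far constraint: another one is not [l'], and its edge to [l] would be
    disjoint from the edge between [c] and [l']. So [w3] keeps all of [T v] except one [p], and lies
    on the edge of [v] obtained by dropping [p]. *)
Lemma star_drop l l' w : l \notin T v -> l' \notin T v -> l != c -> l' != c -> l != l' ->
  adjacent c l' -> ~ adjacent l l' ->
  vertex u g w -> c \in T w -> l \in T w -> exists2 p, exits_to l p & p \notin T w.
Proof.
move=> lv l'v lc l'c ll' acl' nll' vw cw lw.
have [w3 vw3 [sub cw3]] := vertex_drop norec (simple vw) vw cw.
have lw3 : l \in T w3 by apply: (fintype.subsetP sub); rewrite in_setD1 lc.
have far e : e \in T w3 -> e \notin T v -> e = l.
  move=> ew3 ev; apply/eqP/negPn/negP => el.
  have ec : e != c by apply: contraNneq cw3 => <-.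
  have [el'|el'] := eqVneq e l'; first by apply: nll'; exists w3; rewrite -?el' //; exact: vw3.1.
  apply: (@no_far_matching l e c l') => //; last by exists w3 => //; exact: vw3.1.
  by rewrite /= !inE !negb_or eq_sym el lc ll' ec el' eq_sym l'c.
(* Otherwise [T w3] would contain [T v] and [l], against simplicity. *)
have [p pv3] : exists p, p \in T v :\: T w3.
  apply/set0Pn; rewrite -cards_eq0 -lt0n ltnNge leqn0 cards_eq0 finset.setD_eq0; apply/negP => vw3s.
  have := @card_above _ [:: l] vw3s isT; rewrite /= lw3 lv => /(_ isT isT).
  by rewrite addn1 ltnNge (simple vw3).
have c1 : (#|T v :\: T w3| <= 1)%N.
  have sub3 : T w3 \subset (T v :&: T w3) :|: [set l].
    apply/fintype.subsetP => i iw; rewrite finset.in_setU finset.in_setI finset.in_set1 iw andbT.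
    by apply/orP; case: (boolP (i \in T v)) => iv; [left|right; rewrite (far _ iw iv)].
  have := leq_card_exchange (leq_trans (simple vv) (vertex_card vw3)) sub3.
  by rewrite cards1.
have := pv3; rewrite finset.in_setD => /andP[pw3 pv].
exists p.
  split => //; exists w3; first exact: vw3.1.
  split => //; apply/fintype.subsetP => i; rewrite in_setD1 => /andP[ip iv].
  apply/negPn/negP => iw3; case/negP: ip; apply/eqP.
  by apply: ((card_le1_eqP c1) p i pv3 _); rewrite finset.in_setD iw3.
apply: contra pw3 => pw; apply: (fintype.subsetP sub); rewrite in_setD1 pw andbT.
by apply: contraNneq cv => <-.
Qed.

(** If [p] were tight at [w], then [w] and the point [y] on the edge dropping [p] would meet all
    faces of [T v] and those of [c], [l], [l']. *)
Lemma star_avoid l l' w p : l \notin T v -> l' \notin T v -> l != c -> l' != c -> l != l' ->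
  vertex u g w -> c \in T w -> l \in T w -> exits_to l' p -> p \notin T w.
Proof.
move=> lv l'v lc l'c ll' vw cw lw [pv [y Py [sub l'y]]]; apply/negP => pw.
apply: (no_pair vw.1 Py); apply: (@card_above _ [:: c; l; l']) => //.
- apply/fintype.subsetP => i iv; rewrite finset.in_setU.
  have [->|ip] := eqVneq i p; first by rewrite pw.
  by rewrite (fintype.subsetP sub) ?orbT // in_setD1 ip.
- by rewrite /= !inE negb_or ll' !(eq_sym c) lc l'c.
- by rewrite /= !finset.in_setU cw lw l'y !orbT.
- by rewrite /= cv lv l'v.
Qed.

(** A vertex in the face of [c] and in that of [l] or [l'] loses at most two constraints of [T v].
    At [w'] both [p'] and every constraint whose edge ends in [l] are lost, so [p] is the only one
    of the latter kind. *)
Lemma no_star l l' : (3 <= n)%N -> l \notin T v -> l' \notin T v ->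
  l != c -> l' != c -> l != l' ->
  adjacent c l -> adjacent c l' -> ~ adjacent l l' -> False.
Proof.
move=> n3 lv l'v lc l'c ll' acl acl' nll'.
have nl'l : ~ adjacent l' l by move/adjacentC.
have l'l : l' != l by rewrite eq_sym.
have atv d : adjacent c d -> exists2 w, vertex u g w & c \in T w /\ d \in T w.
  case=> x Px [cx dx]; have [w vw [sub _]] := vertex_ge norec 0 Px.
  by exists w => //; split; exact: (fintype.subsetP sub).
have [w vw [cw lw]] := atv _ acl; have [w' vw' [cw' l'w']] := atv _ acl'.
have [p' Xp' p'w'] := star_drop l'v lv l'c lc l'l acl nl'l vw' cw' l'w'.
have [p Xp pw] := star_drop lv l'v lc l'c ll' acl' nll' vw cw lw.
have inD x y z : x \in T v -> y \in T v -> z \in T v -> forall w0, vertex u g w0 ->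
   (#|T v :\: T w0| <= 2)%N -> uniq [:: x; y; z] ->
   x \notin T w0 -> y \notin T w0 -> z \notin T w0 -> False.
  move=> xv yv zv w0 vw0 c2 us xw yw zw.
  have : (#|[:: x; y; z]| <= #|T v :\: T w0|)%N.
    apply/subset_leq_card/fintype.subsetP => i; rewrite !inE => /or3P[] /eqP ->.
    - by move: xw xv; rewrite !inE => -> ->.
    - by move: yw yv; rewrite !inE => -> ->.
    - by move: zw zv; rewrite !inE => -> ->.
  by rewrite (card_uniqP us) /= => /leq_trans/(_ c2).
have uniqX q : exits_to l q -> q = p.
  move=> Xq; apply/eqP/negPn/negP => qp.
  apply: (inD q p p' Xq.1 Xp.1 Xp'.1 w' vw') => //.
  - exact: (@star_vertex_card l').
  - rewrite /= !inE !negb_or qp /= andbT; apply/andP; split; apply/eqP => E.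
      by apply: (exits_to_inj lv l'v nll' Xq); rewrite E.
    by apply: (exits_to_inj lv l'v nll' Xp); rewrite E.
  - exact: (@star_avoid l' l).
  - exact: (@star_avoid l' l).
have p'w : p' \notin T w by exact: (@star_avoid l l').
(* As [n] is at least 3, [w] keeps some [q] of [T v]. Dropping it gives a vertex [w2] in the same
   two faces that has lost [p], [p'] and [q], one too many. *)
have [q qI] := card_setD_lt (leq_ltn_trans (star_vertex_card lv lc vw cw lw)
  (leq_trans n3 (vertex_card vv))).
have := qI; rewrite finset.in_setI => /andP[qv qw].
have [w2 vw2 [sub qw2]] := vertex_drop norec (simple vw) vw qw.
have cw2 : c \in T w2.
  by apply: (fintype.subsetP sub); rewrite in_setD1 cw andbT; apply: contraNneq cv => ->.
have lw2 : l \in T w2.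
  by apply: (fintype.subsetP sub); rewrite in_setD1 lw andbT; apply: contraNneq lv => ->.
have [p2 /uniqX -> pw2] := star_drop lv l'v lc l'c ll' acl' nll' vw2 cw2 lw2.
apply: (inD p p' q Xp.1 Xp'.1 qv w2 vw2) => //.
- exact: (@star_vertex_card l).
- rewrite /= !inE !negb_or andbT; apply/andP; split; [apply/andP; split|].
  + by apply/eqP => E; apply: (exits_to_inj lv l'v nll' Xp); rewrite E.
  + by apply: contraNneq pw => ->.
  + by apply: contraNneq p'w => ->.
- exact: (@star_avoid l l').
Qed.

End Star.

(** Connectedness yields a path with centre [c] and ends [l], [l'] among the far faces. The ends are
    adjacent because stars are excluded. A fourth far face would have an edge disjoint from some
    side of this triangle; if there is none, the three faces have a common point. *)
Lemma no_simple_vertex : (3 <= n)%N -> (n + 3 <= #|I|)%N -> False.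
Proof.
move=> n3 In.
have c3 : (3 <= #|~: T v|%SET)%N.
  by rewrite -(leq_add2l n) (leq_trans In) // -(cardsC (T v)) leq_add2r simple.
have other (s : seq I) : (size s < 3)%N -> exists2 d, d \notin T v & d \notin s.
  move=> s3; apply: contrapT => h.
  suff : (#|~: T v|%SET <= #|s|)%N.
    by move=> /(leq_trans c3)/leq_trans/(_ (card_size s)); rewrite leqNgt s3.
  apply/subset_leq_card/fintype.subsetP => i; rewrite finset.in_setC => iv.
  by apply/negPn/negP => is_; apply: h; exists i.
have [i0 i0v _] := other [::] isT.
have [d dv] := other [:: i0] isT; rewrite inE => di0.
have [j0 [j0v ji0 a0]] := far_edge i0v dv di0.
have [e ev] := other [:: i0; j0] isT; rewrite !inE negb_or => /andP[ei0 ej0].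
have [c [l' [cE l'v l'i0 l'j0 acl']]] := far_edge2 i0v j0v ev ei0 ej0.
have [l [[cv lv lc l'c ll'] acl]] : exists l,
    [/\ c \notin T v, l \notin T v, l != c, l' != c & l != l'] /\ adjacent c l.
  have i0l' : i0 != l' by rewrite eq_sym.
  have j0l' : j0 != l' by rewrite eq_sym.
  have ij0 : i0 != j0 by rewrite eq_sym.
  case: cE => ->; first by exists j0; split => //; split.
  by exists i0; split; [split|exact: adjacentC].
have cl' : c != l' by rewrite eq_sym.
have cl : c != l by rewrite eq_sym.
have l'l : l' != l by rewrite eq_sym.
have [all'|] := pselect (adjacent l l'); last exact: (no_star cv n3 lv l'v lc l'c ll').
have [[d1 d1v]|alls] := pselect (exists2 d, d \notin T v & d \notin [:: c; l; l']).
  rewrite !inE !negb_or => /and3P[dc dl dl'].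
  have cd : c != d1 by rewrite eq_sym.
  have [f [fv fd adf]] := far_edge d1v cv cd.
  have [fc|fc] := eqVneq f c.
    apply: (@no_far_matching d1 c l l') => //; last by rewrite -fc.
    by rewrite /= !inE !negb_or dc dl dl' cl cl' ll'.
  have [fl|fl] := eqVneq f l.
    apply: (@no_far_matching d1 l c l') => //; last by rewrite -fl.
    by rewrite /= !inE !negb_or dc dl dl' lc ll' cl'.
  have [fl'|fl'] := eqVneq f l'.
    apply: (@no_far_matching d1 l' c l) => //; last by rewrite -fl'.
    by rewrite /= !inE !negb_or dc dl dl' l'c l'l cl.
  apply: (@no_far_matching d1 f c l) => //.
  by rewrite /= !inE !negb_or dc dl (eq_sym d1) fd fc fl cl.
have [xcl Pcl [ccl lcl]] := acl; have [xcl' Pcl' [ccl' lcl']] := acl'.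
have [xll' Pll' [lll' l'll']] := all'.
have abc i : i \notin T v -> [\/ i = c, i = l | i = l'].
  move=> iv; have [|/eqP ic] := eqVneq i c; first by constructor 1.
  have [|/eqP il] := eqVneq i l; first by constructor 2.
  have [|/eqP il'] := eqVneq i l'; first by constructor 3.
  by case: alls; exists i => //; rewrite !inE !negb_or; apply/and3P; split; apply/eqP.
have [p Pp [cp lp l'p]] := far_triangle norec vv cv lv l'v abc
  Pcl Pll' Pcl' ccl lcl lll' l'll' ccl' lcl'.
apply: (@no_far_triple c l l' p) => //.
by rewrite /= !inE negb_or cl cl' ll'.
Qed.

End AtVertex.
End SimplePolytope.

Lemma compl_card_le (I : finType) (U : {set I}) (n c k : nat) :
  (n + c.+1 <= #|U|)%N -> (#|I| <= n + k + 1)%N -> (c + #|~: U|%SET <= k)%N.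
Proof. by have := cardsC U; lia. Qed.

Lemma compl_card_shift (I : finType) (U V : {set I}) (c k : nat) :
  (#|~: U|%SET <= k)%N -> (#|U| + c <= #|V|)%N -> (c + #|~: V|%SET <= k)%N.
Proof. by have := cardsC U; have := cardsC V; lia. Qed.

(** * Completing partial covers to hitting sets *)

Section Hitting.
Variables (R : realType) (n : nat) (I : finType).
Variables (u : I -> 'rV[R]_n) (g : I -> R).
Local Notation P := (hpoly u g).
Local Notation T := (tight u g).
Hypothesis norec : no_recession u.
Hypothesis hit : forall i, exists2 x, P x & i \in T x.

Lemma cover_rest (k : nat) (s : seq 'rV[R]_n) (U : {set I}) :
  (forall x, x \in s -> P x) -> (forall i, i \in U -> exists2 x, x \in s & i \in T x) ->
  (size s + #|~: U|%SET <= k)%N ->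
  exists s' : seq 'rV[R]_n, [/\ (size s' <= k)%N, forall x, x \in s' -> P x
    & forall i, exists2 x, x \in s' & i \in T x].
Proof.
move=> sP sU sk; have /choice[f fP] i : exists x, P x /\ i \in T x by have [x] := hit i; exists x.
exists (s ++ [seq f i | i <- enum (~: U)%SET]); split.
- by rewrite size_cat size_map -cardE.
- by move=> x; rewrite mem_cat => /orP[/sP //|/mapP[i _ ->]]; exact: (fP i).1.
move=> i; have [/sU[x xs ix]|iU] := boolP (i \in U).
  by exists x => //; rewrite mem_cat xs.
exists (f i); last exact: (fP i).2.
by rewrite mem_cat map_f ?orbT // mem_enum finset.in_setC.
Qed.

Lemma hitting_points (k : nat) : (3 <= n)%N -> (2 <= k)%N -> (#|I| <= n + k + 1)%N ->
  P !=set0 ->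
  exists s : seq 'rV[R]_n, [/\ (size s <= k)%N, forall x, x \in s -> P x
    & forall i, exists2 x, x \in s & i \in T x].
Proof.
move=> n3 k2 Ik [x0 Px0]; have [v0 vv0 _] := vertex_ge norec 0 Px0.
apply: contrapT => nocover.
have no_single w : P w -> ~ (1 + #|~: T w|%SET <= k)%N.
  move=> Pw wk; apply: nocover; apply: (@cover_rest k [:: w] (T w)) => //.
    by move=> x; rewrite mem_seq1 => /eqP ->.
  by move=> i iw; exists w; rewrite ?mem_seq1.
have no_two w w' : P w -> P w' -> ~ (2 + #|~: (T w :|: T w')|%SET <= k)%N.
  move=> Pw Pw' wk; apply: nocover; apply: (@cover_rest k [:: w; w'] (T w :|: T w')) => //.
    by move=> x; rewrite mem_seq2 => /orP[] /eqP ->.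
  move=> i /finset.setUP[iw|iw]; first by exists w; rewrite // mem_seq2 eqxx.
  by exists w'; rewrite // mem_seq2 eqxx orbT.
have no_three w w' w'' : P w -> P w' -> P w'' ->
    ~ (3 + #|~: (T w :|: T w' :|: T w'')|%SET <= k)%N.
  move=> Pw Pw' Pw'' wk; apply: nocover.
  apply: (@cover_rest k [:: w; w'; w''] (T w :|: T w' :|: T w'')) => //.
    by move=> x; rewrite mem_seq3 => /or3P[] /eqP ->.
  move=> i /finset.setUP[/finset.setUP[iw|iw]|iw].
  - by exists w; rewrite // mem_seq3 eqxx.
  - by exists w'; rewrite // mem_seq3 eqxx orbT.
  - by exists w''; rewrite // mem_seq3 eqxx !orbT.
(* Fewer than [k] far faces are met by one point each besides [v]; with exactly [k], a point on an
   edge between two of them saves the missing point. *)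
have far_k v : vertex u g v -> (k < #|~: T v|%SET)%N.
  move=> vv; rewrite ltn_neqAle; apply/andP; split; last first.
    by rewrite -ltnS ltnNge; apply/negP/no_single; exact: vv.1.
  apply/eqP => kv; have /card_gt1P[a [d [/finset.setCP/negP av /finset.setCP/negP dv ad]]] :
    (1 < #|~: T v|%SET)%N by rewrite -kv.
  have da : d != a by rewrite eq_sym.
  have [j [jv ja [x Px [ax jx]]]] := far_edge norec hit vv av dv da.
  apply: (no_two _ _ vv.1 Px).
  have : (#|T v| + size [:: a; j] <= #|T v :|: T x|)%N.
    apply: card_setU_seq; first by rewrite /= inE eq_sym ja.
    by move=> i; rewrite mem_seq2 => /orP[] /eqP ->.
  by apply: compl_card_shift; rewrite -kv.
apply: (@no_simple_vertex _ _ _ _ _ norec hit _ _ _ v0 vv0 n3).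
(* With more than [n] constraints tight at [v], at most [k] far faces would be left. *)
- move=> v vv; rewrite leqNgt; apply/negP => vn.
  have := far_k _ vv; rewrite ltnNge => /negP; apply.
  by apply: (@compl_card_le _ (T v) n 0 k _ Ik); rewrite addn1.
- by move=> w w' Pw Pw' h; apply: (no_two _ _ Pw Pw'); exact: (@compl_card_le _ _ n 2 k h Ik).
- move=> w w' w'' Pw Pw' Pw'' h; apply: (no_three _ _ _ Pw Pw' Pw'').
  exact: (@compl_card_le _ _ n 3 k h Ik).
rewrite -(cardsC (T v0)); apply: leq_add; first exact: vertex_card.
exact: leq_ltn_trans k2 (far_k _ vv0).
Qed.

End Hitting.

(** * Facets of a polytope *)

Lemma card_le_family (T : choiceType) (A : set T) (m : nat) : A #<= `I_m ->
  exists (I : finType) (p : I -> T), A = range p /\ (#|I| <= m)%N.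
Proof.
move=> Am; have fA : finite_set A by apply/finite_set_leP; exists m.
exists (fset_set A : finType), (fun i => fsval i); split; last first.
  by rewrite -cardfE; exact: geq_card_fset_set.
apply/seteqP; split=> [x Ax|_ [i _ <-]].
  have xX : x \in fset_set A by rewrite in_fset_set // mem_set.
  by exists [` xX]%fset.
by have := fsvalP i; rewrite in_fset_set // => /set_mem.
Qed.

Section Topology.
Variables (R : realType) (n : nat).
Implicit Types (C : set 'rV[R]_n) (u x y z : 'rV[R]_n).

Lemma inner_continuous u : continuous (inner u : 'rV[R]_n -> R).
Proof.
rewrite /inner; apply: continuous_big; first exact: add_continuous.
move=> i _ x; apply: (@continuous_comp _ _ _ (fun M : 'rV[R]_n => M 0 i) ( *%R (u 0 i))).
  exact: coord_continuous.
exact: mulrl_continuous.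
Qed.

Lemma sqnorm_continuous x : continuous (fun y : 'rV[R]_n => inner (x - y) (x - y)).
Proof.
rewrite /inner; apply: continuous_big; first exact: add_continuous.
move=> i _ y.
rewrite (_ : (fun _ => _) = (fun r => (x 0 i - r) * (x 0 i - r)) \o (fun M : 'rV[R]_n => M 0 i)).
  apply: continuous_comp; first exact: coord_continuous.
  by apply: cvgM; apply: cvgB; exact: cvg_cst || exact: cvg_id.
by apply/funext => w; rewrite /= !mxE.
Qed.

Lemma inner_max C u : compact C -> C !=set0 ->
  exists2 c, C c & forall y, C y -> inner u y <= inner u c.
Proof.
move=> cC C0; have [|c /set_mem Cc cm] := EVT_max_rV (f := inner u) C0 cC.
  by apply: continuous_subspaceT; exact: inner_continuous.
by exists c => // y Cy; apply: cm; exact: mem_set.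
Qed.

Lemma interior_ray C x z : C° x -> exists2 t : R, 0 < t & C (x + t *: z).
Proof.
move=> Cx.
have cf : x + t *: z @[t --> (0 : R)^'+] --> x + 0 *: z.
  apply: cvgD; first exact: cvg_cst.
  by apply: cvgZr_tmp; apply: cvg_at_right_filter; exact: cvg_id.
rewrite scale0r addr0 in cf.
have h := cf _ Cx.
have [t [t0 Ct]] : exists t : R, 0 < t /\ C (x + t *: z).
  apply: (@filter_ex _ (0^'+)).
  by apply: filterI => //; exact: nbhs_right_gt.
by exists t.
Qed.

Lemma interior_inner_lt C u (c : R) x : C° x -> u != 0 ->
  (forall y, C y -> inner u y <= c) -> inner u x < c.
Proof.
move=> Cx u0 uc; have [t t0 /uc] := interior_ray u Cx.
rewrite innerDr innerZr => h; apply: lt_le_trans h.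
by rewrite ltrDl mulr_gt0 // inner_gt0.
Qed.

Lemma separation C x : convex_set (C : set (convex_lmodType 'rV[R]_n)) ->
  compact C -> C !=set0 -> ~ C x ->
  exists u, forall y, C y -> inner u y < inner u x.
Proof.
move=> /convex_setE cvC cC C0 nCx.
have [|p /set_mem Cp pmin] := EVT_min_rV (f := fun y => inner (x - y) (x - y)) C0 cC.
  by apply: continuous_subspaceT; exact: sqnorm_continuous.
exists (x - p) => y Cy.
have u0 : 0 < inner (x - p) (x - p).
  by rewrite inner_gt0 subr_eq0; apply: contraPneq nCx => ->; case.
suff : inner (x - p) (y - p) <= 0 by move: u0; rewrite !innerBr; lra.
rewrite leNgt; apply/negP => d0.
have N0 : 0 < inner (y - p) (y - p).
  by rewrite inner_gt0; apply: contraTneq d0 => ->; rewrite inner0r ltxx.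
set d := inner (x - p) (y - p) in d0; set N := inner (y - p) (y - p) in N0.
(* Moving from the nearest point [p] by the fraction [t] towards [y] changes the squared distance to
   [x] by [t ^+ 2 * N - 2 * t * d], which is negative for this [t]. *)
pose t := Num.min 1 (d / N).
have t0 : 0 < t by rewrite lt_min ltr01 divr_gt0.
have t1 : t <= 1 by rewrite ge_min lexx.
have td : t * N <= d by rewrite -ler_pdivlMr // ge_min lexx orbT.
have Ct : C (t *: y + (1 - t) *: p) by apply: cvC => //; rewrite (ltW t0).
have := pmin _ (mem_set Ct).
have -> : x - (t *: y + (1 - t) *: p) = (x - p) - t *: (y - p).
  by apply/rowP => i; rewrite !mxE; ring.
have -> (a b : 'rV[R]_n) : inner (a - t *: b) (a - t *: b) =
    inner a a - 2 * t * inner a b + t ^+ 2 * inner b b.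
  by rewrite innerBr !innerBl !innerZl !innerZr (innerC b a); ring.
rewrite -/d -/N; nra.
Qed.

(** A nonzero recession direction [z] could be added to a point maximizing [inner z]. *)
Lemma hpoly_no_recession (I : finType) (u : I -> 'rV[R]_n) (h : I -> R) :
  compact (hpoly u h) -> hpoly u h !=set0 -> no_recession u.
Proof.
move=> cP P0 z zu; apply/eqP/negPn/negP => z0; have [x Px] := P0.
have [c Pc cmax] := inner_max z cP P0.
have zz : 0 < inner z z by rewrite inner_gt0.
have : hpoly u h (c + z).
  by move=> i; rewrite innerDr; have := Pc i; have := zu i; lra.
by move/cmax; rewrite innerDr gerDl leNgt zz.
Qed.

End Topology.

Section AffineHull.
Variables (R : realType) (n : nat).
Implicit Types (A F : set 'rV[R]_n) (w x y z : 'rV[R]_n).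

Lemma affine_hull_affine A : affine_set (affine_hull A).
Proof. by move=> x y t Ax Ay B BA; apply: (BA.1); [exact: Ax|exact: Ay]. Qed.

Lemma sub_affine_hull A : A `<=` affine_hull A.
Proof. exact: sub_smallest. Qed.

Lemma affine_set_sum A p0 (J : finType) (p : J -> 'rV[R]_n) (c : J -> R) :
  affine_set A -> A p0 -> (forall j, A (p j)) -> A (p0 + \sum_j c j *: (p j - p0)).
Proof.
move=> aA A0 Ap.
have addA z z' : A (p0 + z) -> A (p0 + z') -> A (p0 + (z + z')).
  (* The sum is reached by doubling, from [p0], the midpoint of the two points. *)
  move=> Az Az'; have := aA _ _ 2 A0 (aA _ _ 2^-1 Az Az').
  by congr A; apply/rowP => i; rewrite !mxE; field.
suff K (r : seq J) : A (p0 + \sum_(j <- r) c j *: (p j - p0)) by exact: K.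
elim: r => [|j r IH]; first by rewrite big_nil addr0.
rewrite big_cons; apply: addA => //.
have := aA _ _ (c j) A0 (Ap j); congr A; apply/rowP => i; rewrite !mxE; ring.
Qed.

(** Passes from the orthogonality form of spanning to linear combinations: the matrix of the chosen
    vectors has full rank. *)
Lemma spanning_comb (I : finType) (v : I -> 'rV[R]_n) (A : {set I}) y : spanning v A ->
  exists c : 'I_#|A| -> R, y = \sum_k c k *: v (enum_val k).
Proof.
move=> sA; pose M := \matrix_(k < #|A|) v (enum_val k).
have fM : row_full M.
  rewrite /row_full -mxrank_tr -/(row_free _) -kermx_eq0 -submx0.
  apply/row_subP => i; rewrite submx0; apply/eqP; apply: sA => j jA.
  have /sub_kermxP/rowP/(_ (enum_rank_in jA j)) := row_sub i (kermx M^T).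
  rewrite !mxE => E; rewrite innerC -{}[RHS]E /inner; apply: eq_bigr => k _.
  by rewrite !mxE enum_rankK_in.
have /submxP[D ->] := submx_full y fM.
exists (fun k => D 0 k); rewrite mulmx_sum_row; apply: eq_bigr => k _.
by rewrite rowK.
Qed.

Definition orthv w : {vspace 'rV[R]_n} := lker (linfun (mulmxr w^T : 'rV[R]_n -> 'M[R]_1)).

Lemma mem_orthv w x : (x \in orthv w) = (inner w x == 0).
Proof.
rewrite memv_ker lfunE /=; apply/eqP/eqP => [/rowP/(_ 0)|h].
  rewrite !mxE => h; rewrite innerC -[RHS]h /inner.
  by apply: eq_bigr => i _; rewrite mxE.
apply/matrixP => i j; rewrite !mxE !ord1; apply: etrans h; rewrite innerC.
by apply: eq_bigr => k _; rewrite mxE.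
Qed.

Lemma dim_orthv w : w != 0 -> \dim (orthv w) = n.-1.
Proof.
move=> w0; rewrite /orthv; set f := linfun _.
have := limg_ker_dim f fullv; rewrite capfv dimvf /dim /= mul1n.
have -> : \dim (f @: fullv) = 1%N.
  apply/eqP; rewrite eqn_leq; apply/andP; split.
    by apply: leq_trans (dimvS (subvf _)) _; rewrite dimvf /dim /= muln1.
  rewrite lt0n dimv_eq0; apply: contraNneq w0 => E.
  have : f w \in (f @: fullv)%VS by rewrite memv_img // memvf.
  by rewrite E memv0 -memv_ker -[lker f]/(orthv w) mem_orthv inner_eq0.
by rewrite addn1 => /(congr1 predn).
Qed.

Lemma hyperplane_affine w (c : R) : affine_set [set y | inner w y = c].
Proof. by move=> x y t /= xc yc; rewrite innerDr !innerZr xc yc; ring. Qed.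

Lemma has_dim_hyperplane F w (c : R) p0 : w != 0 -> F p0 ->
  F `<=` [set y | inner w y = c] ->
  [set y | inner w y = c] `<=` affine_hull F -> has_dim F n.-1.
Proof.
move=> w0 Fp0 FH HF; exists p0, (orthv w); last exact: dim_orthv.
have -> : affine_hull F = [set y | inner w y = c].
  apply/seteqP; split=> //.
  by apply: smallest_sub => //; exact: hyperplane_affine.
have p0c : inner w p0 = c by exact: FH.
apply/seteqP; split=> [y yc|_ [z zU <-]] /=.
  exists (y - p0); last by rewrite addrC subrK.
  by rewrite /= mem_orthv innerBr yc p0c subrr.
by move: zU; rewrite /= mem_orthv innerDr p0c => /eqP ->; rewrite addr0.
Qed.

End AffineHull.

Lemma oner_rV_neq0 (R : realType) (n : nat) : (0 < n)%N -> const_mx 1 != 0 :> 'rV[R]_n.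
Proof.
by move=> n0; apply/eqP => /rowP/(_ (Ordinal n0)); rewrite !mxE => /eqP; rewrite oner_eq0.
Qed.

(** * Facet inequalities from the polar body *)

Section DualPolyhedron.
Variables (R : realType) (n : nat) (C : set 'rV[R]_n) (I : finType) (p : I -> 'rV[R]_n).
Variable y0 : 'rV[R]_n.
Hypothesis n_gt0 : (0 < n)%N.
Hypothesis compactC : compact C.
Hypothesis hullC : C = convex_hull (range p).
Hypothesis intC : C° y0.

(** With these vectors [polar] is the polar body of [C - y0]. Distinct vertices of it yield distinct
    facets of [C], and their inequalities cut out [C]. *)
Let q i := p i - y0.
Local Notation polar := (hpoly q (fun=> 1)).
Local Notation polar_vertex := (vertex q (fun=> 1)).

Lemma hull_point i : C (p i).
Proof. by rewrite hullC; apply: sub_convex_hull; exists i. Qed.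

Lemma hull_le u (c : R) y : (forall i, inner u (p i) <= c) -> C y -> inner u y <= c.
Proof.
move=> uc; rewrite hullC; apply: (convex_hull_min (@convex_halfspace _ _ u c)).
by move=> _ [i _ <-]; exact: uc.
Qed.

Lemma polar_no_recession : no_recession q.
Proof.
move=> z zq; apply/eqP/negPn/negP => z0.
have : inner z y0 < inner z y0; last by rewrite ltxx.
apply: interior_inner_lt intC z0 _ => y; apply: hull_le => i.
by rewrite -subr_le0 -innerBr innerC zq.
Qed.

Lemma polar_le u y : polar u -> C y -> inner u (y - y0) <= 1.
Proof.
move=> Pu Cy; rewrite innerBr lerBlDr; apply: hull_le Cy => i.
by rewrite -lerBlDr -innerBr innerC; exact: Pu.
Qed.

Lemma polar_separates x : ~ C x ->
  exists2 w, polar_vertex w & 1 < inner w (x - y0).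
Proof.
move=> nCx; have cvC : convex_set (C : set (convex_lmodType 'rV[R]_n)).
  by rewrite hullC; apply: (convex_setE _).2 => a b t; exact: convex_hull_convex.
have Cy0 : C y0 by exact: nbhs_singleton.
have [u ux] := separation cvC compactC (ex_intro _ _ Cy0) nCx.
have u0 : u != 0.
  by apply: contraTneq (ux _ Cy0) => ->; rewrite !inner0l ltxx.
have P0 : polar 0 by move=> i; rewrite inner0r.
(* The separating vector is scaled until it is tight in the polar; its value at [x - y0] then
   exceeds 1, and some vertex does at least as well. *)
have [|t t0 [Pt [j jt /tightP jT]]] := hpoly_step P0 (exists_inner_gt0 polar_no_recession u0).
  by move=> i /tightP; rewrite inner0r => /eqP; rewrite eq_sym oner_eq0.
have [w vw [_ wx]] := vertex_ge polar_no_recession (x - y0) Pt.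
exists w => //; rewrite innerC; apply: lt_le_trans wx.
rewrite -jT add0r !innerZr ltr_pM2l // !(innerC _ u) !innerBr ltrD2r.
exact: ux (hull_point j).
Qed.

Lemma polar_vertex_neq0 w : polar_vertex w -> w != 0.
Proof.
move=> [_ sw]; apply/eqP => w0; have /eqP[] := oner_rV_neq0 R n_gt0.
by apply: sw => i /tightP; rewrite w0 inner0r => /eqP; rewrite eq_sym oner_eq0.
Qed.

Definition polar_face w := C `&` [set y | inner w y = 1 + inner w y0].

Lemma polar_faceE w i : polar_face w (p i) <-> i \in tight q (fun=> 1) w.
Proof.
split; first by case=> _ /= E; apply/tightP; rewrite innerC innerBr E addrK.
move/tightP; rewrite innerC innerBr => E; split; first exact: hull_point.
by rewrite /= -E subrK.
Qed.

(** The points [p i] tight at [w] span the hyperplane affinely: when [y - y0] is written as a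
    combination of their [q i], applying [inner w] shows that the coefficients add up to 1. *)
Lemma polar_vertex_facet w : polar_vertex w -> facet C (polar_face w).
Proof.
move=> vw; have w0 := polar_vertex_neq0 vw; have [Pw sw] := vw; split.
  exists w, (1 + inner w y0); split => // y Cy.
  by rewrite -lerBlDr -innerBr; exact: polar_le.
have [p0 p0T] : exists i, i \in tight q (fun=> 1) w.
  apply/set0Pn; rewrite -card_gt0; exact: leq_trans n_gt0 (vertex_card vw).
apply: (@has_dim_hyperplane _ _ _ w (1 + inner w y0) (p p0)) => //.
- exact/polar_faceE.
- by move=> y [].
move=> y /= yw; have [c yc] := spanning_comb (y - y0) sw.
have c1 : \sum_k c k = 1.
  have E : inner w (y - y0) = 1 by rewrite innerBr yw addrK.
  apply: etrans E; rewrite yc (big_morph (inner w) (@innerDr _ _ w) (inner0r w)).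
  apply: eq_bigr => k _; rewrite innerZr innerC.
  by rewrite (tightP _ _ _ _ (enum_valP k)) mulr1.
have -> : y = p p0 + \sum_k c k *: (p (enum_val k) - p p0).
  apply: (addIr (- y0)); rewrite yc.
  have -> : \sum_k c k *: (p (enum_val k) - p p0) = 
     \sum_k (c k *: q (enum_val k) - c k *: (p p0 - y0)).
    by apply: eq_bigr => k _; rewrite -scalerBr /q opprB addrA subrK.
  by rewrite sumrB -scaler_suml c1 scale1r addrAC addrCA subrr addr0.
apply: affine_set_sum; first exact: affine_hull_affine.
- by apply: sub_affine_hull; apply/polar_faceE.
by move=> k; apply: sub_affine_hull; apply/polar_faceE; exact: enum_valP.
Qed.

Lemma polar_vertex_card_le : [set w | polar_vertex w] #<= facets C.
Proof.
apply: (@card_le_inj _ _ polar_face); last exact: polar_vertex_facet.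
move=> w w' /set_mem vw _ E; apply: (vertex_inj vw).
apply/finset.setP => i; apply/idP/idP => /polar_faceE h; apply/polar_faceE.
  by rewrite -E.
by rewrite E.
Qed.

Lemma facet_hrepresentation (m : nat) : facets C #<= `I_m ->
  exists (J : finType) (u : J -> 'rV[R]_n) (h : J -> R), (#|J| <= m)%N /\ C = hpoly u h.
Proof.
move=> /(card_le_trans polar_vertex_card_le)/card_le_family[J [u [uE Jm]]].
exists J, u, (fun j => 1 + inner (u j) y0); split=> //.
have vu j : polar_vertex (u j) by have : range u (u j); [exists j|rewrite -uE].
apply/seteqP; split=> [y Cy j|y Hy].
  by rewrite -lerBlDr -innerBr; apply: polar_le => //; exact: (vu j).1.
apply: contrapT => /polar_separates[w vw].
have : range u w by rewrite -uE.
by case=> j _ <-; rewrite ltNge innerBr lerBlDr Hy.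
Qed.

End DualPolyhedron.

(** * Generating ball convex sets of a polytope with few facets *)

Section BallConvex.
Variables (R : realType) (n : nat).
Implicit Types (A C K D : set 'rV[R]_n).

Lemma translateE C x y : translate C x y <-> C (y - x).
Proof.
split=> [[c Cc <-]|Cyx]; first by rewrite addrC addKr.
by exists (y - x) => //; rewrite addrC subrK.
Qed.

Lemma translate_ball_convex C x : ball_convex C (translate C x).
Proof.
apply: Or33; apply/seteqP; split=> [y Cy z|y]; first exact.
by move=> /(_ x); exact.
Qed.

Lemma ball_convex_hull_eq C K A : K !=set0 -> A `<=` K -> ball_convex C K ->
  (forall x, A `<=` translate C x -> K `<=` translate C x) -> A !=set0 ->
  K = ball_convex_hull C A.
Proof.
move=> K0 AK bK AxK [a Aa]; apply/seteqP; split; last exact: smallest_sub.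
move=> y Ky D [bD AD].
case: bD => [D0|->//|->]; first by have := AD _ Aa; rewrite D0.
by move=> x /= Dx; exact: (AxK x (subset_trans AD Dx) y Ky).
Qed.

Lemma translate_compact C x : compact C -> compact (translate C x).
Proof.
move=> cC; apply: continuous_compact => //; apply: continuous_subspaceT => y.
exact: (@cvgD _ _ _ (nbhs y) _ (cst x) id x y (cvg_cst x) cvg_id).
Qed.

(** In direction [u] the point [y] differs from 0 by one more than the width of [C]. This makes the
    whole space the hull of two points. *)
Lemma unbounded_pair C : compact C -> C !=set0 -> (0 < n)%N ->
  exists y : 'rV[R]_n, forall x, translate C x 0 -> ~ translate C x y.
Proof.
move=> cC C0 n0; pose u : 'rV[R]_n := const_mx 1.
have [c Cc cmax] := inner_max u cC C0; have [d Cd dmax] := inner_max (- u) cC C0.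
have uu : 0 < inner u u.
  by rewrite inner_gt0 oner_rV_neq0.
pose M := inner u c - inner u d.
exists (((M + 1) / inner u u) *: u) => x /translateE/dmax h /translateE/cmax.
rewrite !innerBr innerZr divfK ?lt0r_neq0 //.
by move: h; rewrite innerBr !innerNl inner0r /M; lra.
Qed.

Lemma ball_convex_generated (k : nat) C : (3 <= n)%N -> (2 <= k)%N ->
  n_polytope C -> facets C #<= `I_(n + k + 1)%N -> every_ball_convex_generated C k.
Proof.
move=> n3 k2 [[cC cvC [y0 iC]] [V fV CV]] facetsC K bK.
have n0 : (0 < n)%N by lia.
have Cy0 : C y0 by exact: nbhs_singleton.
have C0 : C !=set0 by exists y0.
have [K0|KN0] := pselect (K = set0).
  exists set0; first exact: card_ge0.
  rewrite K0; apply/esym; rewrite -subset0; apply: smallest_sub => //.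
  by apply: Or31.
have K_neq0 : K !=set0 by apply/set0P/eqP.
have [KT|KNT] := pselect (K = setT).
  have [y yC] := unbounded_pair cC C0 n0.
  exists [set 0; y].
    apply: card_le_trans (_ : _ #<= `I_2) _; last by rewrite card_le_II.
    apply: (@card_le_inj _ _ (fun x : 'rV[R]_n => if x == 0 then 0%N else 1%N)).
      move=> a b /set_mem[]-> /set_mem[]->; rewrite ?eqxx //; by case: eqP => // ->.
    by move=> x _ /=; case: ifP.
  apply: ball_convex_hull_eq => //; last by exists 0; left.
  - by rewrite KT.
  - by move=> x yx; case: (yC x (yx _ (or_introl erefl)) (yx _ (or_intror erefl))).
have {bK} KE : K = \bigcap_(x in [set x | K `<=` translate C x]) translate C x.
  by case: bK.
have bK : ball_convex C K by apply: Or33.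
have [x0 Kx0] : exists x0, K `<=` translate C x0.
  apply: contrapT => h; apply: KNT; rewrite KE -subTset => y _ x Kx.
  by case: h; exists x.
have cK : compact K.
  apply: (@subclosed_compact _ _ (translate C x0)) => //; last exact: translate_compact.
  rewrite KE; apply: closed_bigI => x _; apply: compact_closed.
    exact: norm_hausdorff.
  exact: translate_compact.
have [m Vm] : exists m, V #<= `I_m by apply/finite_set_leP.
have [I [p [pE _]]] := card_le_family Vm.
rewrite pE in CV.
have [J [u [h [Jm Ch]]]] := facet_hrepresentation n0 cC CV iC facetsC.
have norec : no_recession u by apply: (@hpoly_no_recession _ _ _ u h); rewrite -Ch.
(* The bounds [g] are the maxima over [K], attained at the points [a j], so that every face is
   nonempty. *)
have /choice[a aP] j : exists a, K a /\ forall y, K y -> inner (u j) y <= inner (u j) a.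
  by have [a Ka am] := inner_max (u j) cK K_neq0; exists a.
pose g j := inner (u j) (a j).
(* A translate of [C] that contains [K] has bounds no smaller than [g], hence contains
   [hpoly u g]. *)
have KP : K = hpoly u g.
  apply/seteqP; split=> [y Ky j|y Py]; first exact: (aP j).2.
  rewrite KE => x Kx; apply/translateE; rewrite Ch => j.
  have /translateE := Kx _ (aP j).1; rewrite Ch => /(_ j).
  by apply: le_trans; rewrite !innerBr lerD2r; exact: Py.
have hit j : exists2 x, hpoly u g x & j \in tight u g x.
  by exists (a j); [rewrite -KP; exact: (aP j).1|exact/tightP].
have [|s [sk sK sJ]] := hitting_points norec hit n3 k2 Jm; first by rewrite -KP.
exists [set` s].
  apply: card_le_trans (_ : _ #<= `I_(size s)) _; last by rewrite card_le_II.
  apply: (@card_le_inj _ _ (fun x => index x s)).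
    move=> x y /set_mem /= xs /set_mem /= ys E.
    by rewrite -(nth_index 0 xs) E nth_index.
  by move=> x /= xs; rewrite index_mem.
apply: ball_convex_hull_eq => //.
- by move=> x /sK; rewrite -KP.
(* A translate containing [s] has its [j]-th bound at least the value at [z], which is the maximum
   over [K]. *)
- move=> x sx y Ky; apply/translateE; rewrite Ch => j.
  have [z zs /tightP zj] := sJ j.
  have /translateE := sx _ zs; rewrite Ch => /(_ j); rewrite !innerBr zj.
  by apply: le_trans; rewrite lerD2r; exact: (aP j).2.
have [j _] := exists_inner_gt0 norec (oner_rV_neq0 R n0).
by have [z zs _] := sJ j; exists z.
Qed.

End BallConvex.

(** * The truncated simplex *)

Lemma card_finType_II (I : finType) : [set: I] #= `I_#|I|.
Proof.
rewrite card_eq_sym; have -> : `I_#|I| = (fun i : I => val (enum_rank i)) @` [set: I].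
  apply/seteqP; split=> [k kI|_ [i _ <-]]; last exact: ltn_ord.
  by exists (enum_val (Ordinal kI)); rewrite ?enum_valK.
by apply: inj_card_eq => x y _ _ /val_inj; exact: enum_rank_inj.
Qed.

Section SmallStep.
Variables (R : realType) (T : eqType).

Lemma small_step (s : seq T) (a b w : T -> R) : (forall i, i \in s -> a i < b i) ->
  exists2 e : R, 0 < e & forall t i, 0 <= t <= e -> i \in s -> a i + t * w i <= b i.
Proof.
elim: s => [|j s IH] ab; first by exists 1.
have [|e e0 he] := IH; first by move=> i is_; apply: ab; rewrite inE is_ orbT.
have abj : a j < b j by apply: ab; rewrite mem_head.
have w0 : 0 < `|w j| + 1 by rewrite ltr_wpDl.
exists (Num.min e ((b j - a j) / (`|w j| + 1))).
  by rewrite lt_min e0 divr_gt0 // subr_gt0.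
move=> t i /andP[t0]; rewrite le_min => /andP[te tw]; rewrite inE => /orP[/eqP ->|is_].
  rewrite ler_pdivlMr // in tw; have := ler_norm (w j); nra.
by apply: he => //; rewrite t0.
Qed.

End SmallStep.

(** * Facets of a polyhedron given by irredundant inequalities *)

Section IrredundantRepresentation.
Variables (R : realType) (n : nat) (I : finType).
Variables (u : I -> 'rV[R]_n) (h : I -> R) (y : I -> 'rV[R]_n).
Hypothesis u_neq0 : forall i, u i != 0.
Hypothesis y_tight : forall i, inner (u i) (y i) = h i.
Hypothesis y_strict : forall i j, j != i -> inner (u j) (y i) < h j.
Local Notation C := (hpoly u h).

Lemma irredundant_point i : C (y i).
Proof. by move=> j; have [->|/y_strict/ltW//] := eqVneq j i; rewrite y_tight. Qed.

Definition facet_of i := C `&` [set x | inner (u i) x = h i].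

(** Near [y i] only the [i]-th constraint matters, so a short step within its hyperplane stays in
    the facet, and the affine hull is the whole hyperplane. *)
Lemma facet_of_facet i : facet C (facet_of i).
Proof.
split; first by exists (u i), (h i); split => // x; exact.
apply: (@has_dim_hyperplane _ _ _ (u i) (h i) (y i)) => //.
- by split; [exact: irredundant_point|exact: y_tight].
- by move=> x [].
move=> x /= xi; pose d := x - y i.
have di : inner (u i) d = 0 by rewrite innerBr xi y_tight subrr.
have [|e e0 he] := @small_step R I [seq j <- enum I | j != i]
    (fun j => inner (u j) (y i)) h (fun j => inner (u j) d).
  by move=> j; rewrite mem_filter => /andP[/y_strict].
have Fe : facet_of i (y i + e *: d).
  split; last by rewrite /= innerDr innerZr di mulr0 addr0 y_tight.
  move=> j; rewrite innerDr innerZr; have [->|ji] := eqVneq j i.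
    by rewrite di mulr0 addr0 y_tight.
  by apply: he; [rewrite (ltW e0) lexx|rewrite mem_filter ji mem_enum].
have Fy : facet_of i (y i) by split; [exact: irredundant_point|exact: y_tight].
have -> : x = (1 - e^-1) *: y i + e^-1 *: (y i + e *: d).
  by apply/rowP => k; rewrite !mxE; field; rewrite lt0r_neq0.
by apply: affine_hull_affine; exact: sub_affine_hull.
Qed.

Lemma facet_of_inj : injective facet_of.
Proof.
move=> i j E; apply/eqP/negPn/negP; rewrite eq_sym => /y_strict.
have [_ /= ->] : facet_of j (y i); last by rewrite ltxx.
by rewrite -E; split; [exact: irredundant_point|exact: y_tight].
Qed.

Lemma affine_hull_facet (F : set 'rV[R]_n) w (c : R) : w != 0 ->
  F `<=` [set x | inner w x = c] -> has_dim F n.-1 ->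
  affine_hull F = [set x | inner w x = c].
Proof.
move=> w0 Fw [x [U FU dU]].
have sub : affine_hull F `<=` [set x | inner w x = c].
  by apply: smallest_sub => //; exact: hyperplane_affine.
have xc : inner w x = c.
  by apply: sub; rewrite FU; exists 0; rewrite /= ?mem0v ?addr0.
have UE : U = orthv w.
  apply/eqP; rewrite eqEdim dU dim_orthv // leqnn andbT; apply/subvP => z zU.
  rewrite mem_orthv; have : inner w (x + z) = c by apply: sub; rewrite FU; exists z.
  by rewrite innerDr xc => /eqP; rewrite -subr_eq0 addrAC subrr add0r.
apply/seteqP; split=> // z /= zc; rewrite FU UE; exists (z - x).
  by rewrite /= mem_orthv innerBr zc xc subrr.
by rewrite addrC subrK.
Qed.

(** If [F] lay in no constraint hyperplane, averaging would give a point of [F] where every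
    constraint is strict, and a small step along [w] would leave the supporting halfspace but not
    [C]. Otherwise both hyperplanes are the affine hull of [F]. *)
Lemma facetE (F : set 'rV[R]_n) : facet C F -> exists i, F = facet_of i.
Proof.
move=> [[w [c [w0 wc FE]]] dF].
have [z0 Fz0] : F !=set0.
  (* The empty set is affine and so its own hull, whereas a set with a dimension has a nonempty
     hull. *)
  apply/set0P/eqP => F0; have [x [U FU _]] := dF.
  have : affine_hull F x by rewrite FU; exists 0; rewrite /= ?mem0v ?addr0.
  by move=> /(_ set0)[]; split => //; rewrite F0.
have [[i Fi]|nFi] := pselect (exists i, F `<=` [set x | inner (u i) x = h i]).
  exists i; rewrite /facet_of -(affine_hull_facet (u_neq0 i) Fi dF).
  have Fw : F `<=` [set x | inner w x = c] by rewrite FE => x [].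
  by rewrite (affine_hull_facet w0 Fw dF) -FE.
have /choice[z zP] i : exists z, F z /\ inner (u i) z < h i.
  apply: contrapT => nz; apply: nFi; exists i => z Fz; apply/eqP.
  rewrite eq_le; apply/andP; split; first by move: Fz; rewrite FE => -[/(_ i)].
  by rewrite leNgt; apply/negP => lt; apply: nz; exists z.
have convF a b : F a -> F b -> F (2^-1 *: a + (1 - 2^-1) *: b).
  rewrite FE => -[Ca /= ac] [Cb /= bc]; split.
    by apply: ((convex_setE _).1 (@hpoly_convex _ _ _ u h)) => //; lra.
  by rewrite /= innerDr !innerZr ac bc; field.
have [x Fx xlt] : exists2 x, F x & forall i, i \in enum I -> inner (u i) x < h i.
  elim: (enum I) => [|i s [x Fx xlt]]; first by exists z0.
  exists (2^-1 *: x + (1 - 2^-1) *: z i); first by apply: convF => //; exact: (zP i).1.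
  have leC x' j : F x' -> inner (u j) x' <= h j by rewrite FE => -[/(_ j)].
  move=> j; rewrite inE innerDr !innerZr => /orP[/eqP ->|/xlt lt].
    by have := (zP i).2; have := leC _ i Fx; lra.
  by have := leC _ j (zP i).1; lra.
have [e e0 he] := small_step (fun j => inner (u j) w) xlt.
have : C (x + e *: w).
  by move=> i; rewrite innerDr innerZr; apply: he; [rewrite (ltW e0) lexx|rewrite mem_enum].
move/wc; have : inner w x = c by move: Fx; rewrite FE => -[].
move=> <-; rewrite innerDr innerZr gerDl leNgt.
by rewrite mulr_gt0 // inner_gt0.
Qed.

Lemma facets_card : facets C #= `I_#|I|.
Proof.
apply: card_eq_trans (card_finType_II I).
have -> : facets C = facet_of @` [set: I].
  apply/seteqP; split=> [F /facetE[i ->]|_ [i _ <-]]; first by exists i.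
  exact: facet_of_facet.
by apply: inj_card_eq => i j _ _; exact: facet_of_inj.
Qed.

(** The translate of [C] by [- (2^-1 *: y i)] contains [C / 2] and has the same [i]-th bound
    [h i / 2]. *)
Lemma half_ball_convex : ball_convex C (hpoly u (fun i => h i / 2)).
Proof.
apply: Or33; apply/seteqP; split=> [x Kx z|x Hx i]; first exact.
have : translate C (- (2^-1 *: y i)) x.
  apply: Hx => x' Kx'; apply/translateE => j; rewrite opprK innerDr innerZr.
  by have := Kx' j; have := irredundant_point i j; lra.
by move=> /translateE/(_ i); rewrite opprK innerDr innerZr y_tight; lra.
Qed.

(* The witness is [K := C / 2]: it is cut out by the translates [C - x], [x] in [K],
   and a subset of [K] missing the facet [i] of [K] lies in a translate of [C] that
   cuts off that facet. *)
Lemma not_generated (k : nat) (t : 'I_k.+1 -> I) :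
  (forall x j j', C x -> t j \in tight u h x -> t j' \in tight u h x -> j = j') ->
  ~ every_ball_convex_generated C k.
Proof.
move=> tP /(_ _ half_ball_convex)[A Ak KA].
have AK : A `<=` hpoly u (fun i => h i / 2) by rewrite KA; exact: sub_smallest.
have [[j jA]|hitA] := pselect (exists j, forall a, A a -> inner (u (t j)) a < h (t j) / 2).
  have /finite_seqP[s sA] : finite_set A by apply/finite_set_leP; exists k.
  set i := t j in jA; pose d := u i.
  have [|e1 e10 he1] := @small_step R I [seq l <- enum I | l != i]
      (fun l => inner (u l) (y i) / 2) (fun l => h l / 2) (fun l => inner (u l) d).
    by move=> l; rewrite mem_filter => /andP[/y_strict lt _]; rewrite ltr_pM2r ?invr_gt0.
  have [|e2 e20 he2] := @small_step R _ s (fun a => inner (u i) a) (fun=> h i / 2)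
      (fun=> inner (u i) d).
    by move=> a as_; apply: jA; rewrite sA.
  pose e := Num.min e1 e2.
  have e0 : 0 < e by rewrite lt_min e10.
  have ee1 : 0 <= e <= e1 by rewrite ltW //= ge_min lexx.
  have ee2 : 0 <= e <= e2 by rewrite ltW //= ge_min lexx orbT.
  (* Moving [C] by half of [y i] makes its [i]-th bound that of [C / 2] and leaves room in the
     others; the extra shift cuts off the facet. [e1] preserves the other inequalities, [e2] the
     [i]-th one at the points of [A]. *)
  pose x := - (2^-1 *: y i + e *: d).
  have Ax : A `<=` translate C x.
    move=> a Aa; apply/translateE => l; rewrite opprK !innerDr !innerZr.
    have [->|li] := eqVneq l i.
      have := he2 e a ee2; rewrite sA in Aa; move=> /(_ Aa); rewrite y_tight; lra.
    have := he1 e l ee1; rewrite mem_filter li mem_enum => /(_ isT).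
    by have := AK _ Aa l; lra.
  have Kx : hpoly u (fun i => h i / 2) `<=` translate C x.
    by rewrite KA; apply: smallest_sub => //; exact: translate_ball_convex.
  have /Kx/translateE/(_ i) : hpoly u (fun i => h i / 2) (2^-1 *: y i).
    by move=> l; rewrite innerZr; have := irredundant_point i l; lra.
  rewrite opprK !innerDr !innerZr y_tight.
  have : 0 < e * inner (u i) d by rewrite mulr_gt0 // inner_gt0.
  lra.
have /choice[a aP] j : exists a, A a /\ inner (u (t j)) a = h (t j) / 2.
  apply: contrapT => na; apply: hitA; exists j => a Aa.
  by rewrite lt_neqAle AK // andbT; apply/eqP => E; apply: na; exists a.
(* Doubling sends [a j] to a point of [C] on the facet [t j]. No point of [C] lies on two of these
   facets, so [A] would have [k + 1] distinct points. *)
have : [set: 'I_k.+1] #<= `I_k.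
  apply: card_le_trans Ak; apply: (@card_le_inj _ _ a) => [j j' _ _ E|j _]; last exact: (aP j).1.
  have twice l : a l = a j -> t l \in tight u h (2 *: a j).
    by move=> El; apply/tightP; rewrite innerZr -El (aP l).2; field.
  apply: (tP (2 *: a j)); [|exact: twice|exact: twice].
  by move=> i; rewrite innerZr; have := AK _ (aP j).1 i; lra.
by rewrite -(card_le_eql card_II) card_le_II ltnn.
Qed.

End IrredundantRepresentation.

Section TruncatedSimplex.
Variables (R : realType) (n k : nat).
Hypothesis n_gt1 : (1 < n)%N.
Hypothesis kn : (k <= n)%N.
Implicit Types (o : option 'I_n) (x : 'rV[R]_n) (a b : R).

(* [inner (bary_dir o) x + bary_const o] are the barycentric coordinates of [x] in the
   simplex with vertices [0] (index [None]) and the unit vectors. *)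
Definition bary_dir o : 'rV[R]_n := if o is Some i then delta_mx 0 i else const_mx (-1).
Definition bary_const o : R := if o is Some _ then 0 else 1.
Definition bary o x := inner (bary_dir o) x + bary_const o.

Lemma bary_some i x : bary (Some i) x = x 0 i.
Proof.
rewrite /bary addr0 /inner (bigD1 i) //= mxE !eqxx mul1r big1 ?addr0 // => j ji.
by rewrite mxE (negPf ji) andbF mul0r.
Qed.

Lemma bary_none x : bary None x = 1 - \sum_i x 0 i.
Proof.
rewrite /bary addrC /inner -sumrN; congr (_ + _); apply: eq_bigr => i _.
by rewrite mxE mulN1r.
Qed.

Lemma sum_bary x : \sum_o bary o x = 1.
Proof.
rewrite (bigD1 None) //= bary_none (reindex_omap Some id) => [|[]//].
under eq_bigr => i _ do rewrite bary_some.
by rewrite /= [X in _ + X](eq_bigl xpredT) ?subrK // => i; rewrite eqxx.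
Qed.

Lemma bary_add_le x o o' : (forall o, 0 <= bary o x) -> o != o' -> bary o x + bary o' x <= 1.
Proof.
move=> x0 oo'; rewrite -(sum_bary x) (bigD1 o) //= lerD2l (bigD1 o') ?lerDl //=.
  by apply: sumr_ge0.
by rewrite eq_sym.
Qed.

Definition bary_point a b o : 'rV[R]_n := \row_i (if Some i == o then a else b).

Lemma bary_pointE a b o o' : a + n%:R * b = 1 ->
  bary o' (bary_point a b o) = if o' == o then a else b.
Proof.
move=> ab; case: o' => [i|]; first by rewrite bary_some mxE.
rewrite bary_none; under eq_bigr => i _ do rewrite mxE.
case: o => [i0|] /=.
  rewrite (bigD1 i0) //= eqxx (eq_bigr (fun=> b)) => [|i ii0]; last first.
    by rewrite (inj_eq Some_inj) (negPf ii0).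
  rewrite sumr_const cardC1 card_ord -mulr_natl -subn1 natrB ?(ltnW n_gt1) //.
  by rewrite -[X in X - _]ab; ring.
by rewrite sumr_const card_ord -mulr_natl -[X in X - _]ab; ring.
Qed.

(** The vertices to cut off; [insub] gives [None] at the value [n], which occurs only if [k = n]. *)
Definition trunc_index (j : 'I_k.+1) : option 'I_n := insub (val j).

Lemma trunc_index_inj : injective trunc_index.
Proof.
move=> i j; rewrite /trunc_index; apply: contra_eq => ij.
have ik := leq_trans (ltn_ord i : (i <= k)%N) kn; have jk := leq_trans (ltn_ord j : (j <= k)%N) kn.
case: insubP => [i' _ i'E|ni]; case: insubP => [j' _ j'E|nj] //=.
  by apply: contra ij => /eqP[E]; rewrite -val_eqE /= -i'E -j'E E.
case/negP: ij; rewrite -val_eqE /=.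
have -> : val i = n by apply/eqP; rewrite eqn_leq ik leqNgt ni.
by have -> : val j = n by apply/eqP; rewrite eqn_leq jk leqNgt nj.
Qed.

Local Notation I := (option 'I_n + 'I_k.+1)%type.

(** Left indices require barycentric coordinates to be nonnegative, right ones require the chosen
    coordinates to be at most 2/3. *)
Definition trunc_dir (l : I) : 'rV[R]_n :=
  match l with inl o => - bary_dir o | inr j => bary_dir (trunc_index j) end.

Definition trunc_bound (l : I) : R :=
  match l with inl o => bary_const o | inr j => 2 / 3 - bary_const (trunc_index j) end.

(** Centroids of the facets of the simplex and of the cuts. The former have coordinates 0 and 1/n,
    which stay below 2/3. *)
Definition trunc_point (l : I) : 'rV[R]_n :=
  match l with
  | inl o => bary_point 0 n%:R^-1 o
  | inr j => bary_point (2 / 3) (3 * n%:R)^-1 (trunc_index j)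
  end.

Definition truncated_simplex : set 'rV[R]_n := hpoly trunc_dir trunc_bound.

Lemma trunc_inl o x : trunc_bound (inl o) - inner (trunc_dir (inl o)) x = bary o x.
Proof. by rewrite /= innerNl opprK addrC. Qed.

Lemma trunc_inr j x :
  trunc_bound (inr j) - inner (trunc_dir (inr j)) x = 2 / 3 - bary (trunc_index j) x.
Proof. by rewrite /= /bary; ring. Qed.

Lemma trunc_dir_neq0 l : trunc_dir l != 0.
Proof.
have n0 := ltnW n_gt1.
have d0 o : bary_dir o != 0.
  case: o => [i|] /=; apply/eqP => /rowP; last first.
    by move=> /(_ (Ordinal n0)); rewrite !mxE => /eqP; rewrite oppr_eq0 oner_eq0.
  by move=> /(_ i); rewrite !mxE !eqxx => /eqP; rewrite oner_eq0.
by case: l => [ o|j] /=; rewrite ?oppr_eq0.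
Qed.

Lemma trunc_slack l l' :
  0 <= trunc_bound l' - inner (trunc_dir l') (trunc_point l) ?= iff (l' == l).
Proof.
have n2 : (2 : R) <= n%:R by rewrite ler_nat.
have n0 : 0 < n%:R :> R by lra.
have i0 : 0 < n%:R^-1 :> R by rewrite invr_gt0.
have i1 : n%:R^-1 <= 2^-1 :> R by rewrite lef_pV2 ?posrE.
have ab1 : 0 + n%:R * n%:R^-1 = 1 :> R by rewrite add0r mulfV // lt0r_neq0.
have ab2 : 2 / 3 + n%:R * (3 * n%:R)^-1 = 1 :> R by field; rewrite lt0r_neq0.
have E3 : (3 * n%:R)^-1 = 3^-1 * n%:R^-1 :> R by rewrite invfM.
have lt0 (r : R) : 0 < r -> 0 <= r ?= iff false.
  by move=> r0; split; [exact: ltW|rewrite lt_eqF].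
have eq0 (r : R) : r = 0 -> 0 <= r ?= iff true by move=> ->; split; rewrite ?eqxx.
case: l' l => [ o'|j'] [ o|j]; rewrite ?trunc_inl ?trunc_inr /= bary_pointE //.
- rewrite (inj_eq inl_inj); case: eqP => _ ; [exact: eq0|exact: lt0].
- have -> : (inl o' == inr j :> I) = false by [].
  by apply: lt0; rewrite E3; case: ifP; lra.
- have -> : (inr j' == inl o :> I) = false by [].
  by apply: lt0; case: ifP; lra.
rewrite (inj_eq inr_inj) (inj_eq trunc_index_inj); case: eqP => _ ; [apply: eq0|apply: lt0].
  by rewrite subrr.
by rewrite E3; lra.
Qed.

Lemma trunc_point_tight l : inner (trunc_dir l) (trunc_point l) = trunc_bound l.
Proof. by have [_] := trunc_slack l l; rewrite eqxx => /eqP/esym/eqP; rewrite subr_eq0 => /eqP. Qed.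

Lemma trunc_point_strict l l' : l' != l ->
  inner (trunc_dir l') (trunc_point l) < trunc_bound l'.
Proof.
move=> ll'; have := trunc_slack l l'; rewrite (negPf ll') => -[ge0 ne0].
by rewrite -subr_gt0 lt_neqAle ne0.
Qed.

Lemma truncated_simplex_compact : compact truncated_simplex.
Proof.
apply: (@subclosed_compact _ _ [set x : 'rV[R]_n | forall i, `[0, 1]%classic (x ord0 i)]).
- have -> : truncated_simplex = \bigcap_(l : I) [set x | inner (trunc_dir l) x <= trunc_bound l].
    by apply/seteqP; split=> [x Cx l _|x Cx l]; [exact: Cx|exact: (Cx l)].
  apply: closed_bigI => l _; apply: (@closed_comp _ _ (inner (trunc_dir l)) [set r | r <= _]).
    by move=> x _; exact: inner_continuous.
  exact: closed_le.
- exact: (@rV_compact R n (fun=> `[0, 1]%classic) (fun=> @segment_compact R 0 1)).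
move=> x Cx i.
have x0 o : 0 <= bary o x by rewrite -trunc_inl subr_ge0; exact: Cx.
rewrite /= in_itv /= -[x ord0 i]/(x 0 i) -bary_some x0 /=.
by apply: le_trans (@bary_add_le x (Some i) None x0 isT); rewrite lerDl.
Qed.

Lemma truncated_simplex_interior : truncated_simplex° !=set0.
Proof.
(* The barycentre of the simplex: its coordinates are positive and at most 1/3, so every constraint
   is strict. *)
pose b : R := n.+1%:R^-1; exists (bary_point b b None).
have n2 : (3 : R) <= n.+1%:R by rewrite ler_nat.
have b0 : 0 < b by rewrite invr_gt0; lra.
have b1 : b <= 3^-1 by rewrite lef_pV2 ?posrE //; lra.
have bb : b + n%:R * b = 1.
  have E1 : n.+1%:R = n%:R + 1 :> R by rewrite natr1.
  by rewrite /b E1; field; rewrite -E1 pnatr_eq0.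
have E o : bary o (bary_point b b None) = b by rewrite bary_pointE // if_same.
have lt l : inner (trunc_dir l) (bary_point b b None) < trunc_bound l.
  by rewrite -subr_gt0; case: l => [ o|j]; rewrite ?trunc_inl ?trunc_inr E; lra.
have near_s (s : seq I) : nbhs (bary_point b b None)
    [set x | forall l, l \in s -> inner (trunc_dir l) x <= trunc_bound l].
  elim: s => [|l s IH]; first exact: filterS filterT.
  have nl : nbhs (bary_point b b None) [set x | inner (trunc_dir l) x < trunc_bound l].
    apply: (@inner_continuous R n (trunc_dir l) (bary_point b b None) [set r | r < _]).
    by apply: open_nbhs_nbhs; split; [exact: open_lt|exact: lt].
  apply: filterS (filterI nl IH) => x [/ltW xl xs] l'.
  by rewrite inE => /orP[/eqP -> //|/xs].
by apply: filterS (near_s (enum {: I})) => x h l; apply: h; rewrite mem_enum.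
Qed.

Lemma truncated_simplex_polytope : n_polytope truncated_simplex.
Proof.
have cC := truncated_simplex_compact; have iC := truncated_simplex_interior.
have norec : no_recession trunc_dir.
  apply: (@hpoly_no_recession _ _ _ trunc_dir trunc_bound) => //.
  by case: iC => x /nbhs_singleton; exists x.
split; first by split=> //; exact: hpoly_convex.
exists [set x | vertex trunc_dir trunc_bound x]; first exact: finite_vertex.
exact: hpoly_hull.
Qed.

Lemma truncated_simplex_not_generated : [/\ n_polytope truncated_simplex,
  facets truncated_simplex #= `I_(n + k + 2)%N
  & ~ every_ball_convex_generated truncated_simplex k].
Proof.
split; first exact: truncated_simplex_polytope.
  have := facets_card trunc_dir_neq0 trunc_point_tight trunc_point_strict.
  by rewrite card_sum card_option !card_ord (_ : n.+1 + k.+1 = n + k + 2)%N //; lia.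
apply: (not_generated trunc_dir_neq0 trunc_point_tight trunc_point_strict (t := inr)).
move=> x j j' Cx /tightP jx /tightP j'x; apply/eqP/negPn/negP => jj'.
have x0 o : 0 <= bary o x by rewrite -trunc_inl subr_ge0; exact: Cx.
(* Two coordinates equal to 2/3 would add up to more than 1. *)
have := @bary_add_le x (trunc_index j) (trunc_index j') x0.
rewrite (inj_eq trunc_index_inj) => /(_ jj').
have := trunc_inr j x; have := trunc_inr j' x; rewrite jx j'x !subrr; lra.
Qed.

End TruncatedSimplex.

Theorem theorem10 (R : realType) (n : nat) (hn : (3 <= n)%N) :
  (forall k : nat, (2 <= k <= n)%N ->
     exists C : set 'rV[R]_n,
       [/\ n_polytope C, facets C #= `I_(n + k + 2)%N
         & ~ every_ball_convex_generated C k])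
  /\
  (forall k : nat, (2 <= k)%N ->
     forall C : set 'rV[R]_n,
       n_polytope C -> facets C #<= `I_(n + k + 1)%N ->
       every_ball_convex_generated C k).
Proof.
split=> [k /andP[_ kn]|k k2 C]; last exact: ball_convex_generated.
exists (@truncated_simplex R n k); exact: truncated_simplex_not_generated (ltnW hn) kn.
Qed.
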